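(* Let $L=L(\kappa,\tau,\kappa_1,\tau_1,\dots,\kappa_n,\tau_n)$ be a smooth function of finitely many arguments, and let $\mathbf{x}(s)=(x(s),y(s),z(s))^T$ be a smooth space curve, parametrized by Euclidean arc length and with nonvanishing curvature, that is an extremal of the $SE(3)$-invariant variational problem $\int L(\kappa,\tau,\kappa_s,\tau_s,\dots)\,\mathrm{d}s$. Let $\lambda(s)$ and the constant vectors $\mathbf{c}_1=(c_1,c_2,c_3)^T$, $\mathbf{c}_2=(c_4,c_5,c_6)^T$ of Noether's conservation laws be as defined in the context. Then the Euler--Lagrange equations have the two first integrals $$\left(\tau\mathsf{E}^\tau(L)-\kappa\mathsf{E}^\kappa(L)-\lambda(s)\right)^2+\left(-\mathcal{D}_s\mathsf{E}^\kappa(L)-\frac{\tau}{\kappa}\mathcal{D}_s\mathsf{E}^\tau(L)\right)^2+\left(\frac1\kappa\mathcal{D}_s^2\mathsf{E}^\tau(L)-\frac{\kappa_s}{\kappa^2}\mathcal{D}_s\mathsf{E}^\tau(L)+\kappa\mathsf{E}^\tau(L)-\tau\mathsf{E}^\kappa(L)\right)^2=c_1^2+c_2^2+c_3^2$$ and $$\left(\tau\mathsf{E}^\tau(L)-\kappa\mathsf{E}^\kappa(L)-\lambda(s)\right)\mathsf{E}^\tau(L)+\left(-\mathcal{D}_s\mathsf{E}^\kappa(L)-\frac{\tau}{\kappa}\mathcal{D}_s\mathsf{E}^\tau(L)\right)\frac1\kappa\mathcal{D}_s\mathsf{E}^\tau(L)+\left(\frac1\kappa\mathcal{D}_s^2\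mathsf{E}^\tau(L)-\frac{\kappa_s}{\kappa^2}\mathcal{D}_s\mathsf{E}^\tau(L)+\kappa\mathsf{E}^\tau(L)-\tau\mathsf{E}^\kappa(L)\right)\mathsf{E}^\kappa(L)=c_1c_4-c_2c_5+c_3c_6.$$
   Context: Curves are smooth space curves $\mathbf{x}(s)=(x(s),y(s),z(s))^T$ with $|\mathbf{x}_s|=1$ and nonvanishing curvature; subscripts $s$ denote derivatives in $s$, and $\mathcal{D}_s=\mathrm{d}/\mathrm{d}s$. Curvature and torsion are $$\kappa=\frac{\|\mathbf{x}_s\times\mathbf{x}_{ss}\|}{\|\mathbf{x}_s\|^3},\qquad \tau=\frac{\mathbf{x}_{sss}\cdot(\mathbf{x}_s\times\mathbf{x}_{ss})}{\|\mathbf{x}_s\times\mathbf{x}_{ss}\|^2},$$ with $\kappa_m=\partial^m\kappa/\partial s^m$, $\tau_m=\partial^m\tau/\partial s^m$. The Euler operators are $\mathsf{E}^\kappa(L)=\sum_{m\ge0}(-1)^m\mathcal{D}_s^m(\partial L/\partial\kappa_m)$ and $\mathsf{E}^\tau(L)=\sum_{m\ge0}(-1)^m\mathcal{D}_s^m(\partial L/\partial\tau_m)$. All expressions in $L$ are evaluated along the curve. Put $$\lambda(s)=2\tau\mathsf{E}^\tau(L)-L+\sum_{m\ge1}\sum_{i=0}^{m-1}(-1)^i\mathcal{D}_s^i\left(\frac{\partial L}{\partial\kappa_m}\right)\kappa_{m-i}+\sum_{m\ge1}\sum_{i=0}^{m-1}(-1)^i\mathcal{D}_s^i\left(\frac{\partial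 L}{\partial\tau_m}\right)\tau_{m-i}.$$ An extremal curve is a curve that is a critical point of the functional $\int L\,\mathrm{d}s$ under all smooth compactly supported variations of the curve, where for each varied curve $\mathrm{d}s$, $\partial_s$, $\kappa$, $\tau$ denote arc length, arc-length derivative, curvature and torsion of that varied curve. Along an extremal, Noether's conservation laws for the $SE(3)$-invariance read $$\begin{pmatrix}\rho_{FS}&\mathbf{0}\\ DX\rho_{FS}&D\rho_{FS}D\end{pmatrix}\boldsymbol{\upsilon}(I)=\begin{pmatrix}\mathbf{c}_1\\ \mathbf{c}_2\end{pmatrix},\qquad \boldsymbol{\upsilon}(I)=\begin{pmatrix}\tau\mathsf{E}^\tau(L)-\kappa\mathsf{E}^\kappa(L)-\lambda(s)\\ -\mathcal{D}_s\mathsf{E}^\kappa(L)-\frac{\tau}{\kappa}\mathcal{D}_s\mathsf{E}^\tau(L)\\ \frac1\kappa\mathcal{D}_s^2\mathsf{E}^\tau(L)-\frac{\kappa_s}{\kappa^2}\mathcal{D}_s\mathsf{E}^\tau(L)+\kappa\mathsf{E}^\tau(L)-\tau\mathsf{E}^\kappa(L)\\ \mathsf{E}^\tau(L)\\ -\frac1\kappa\mathcal{D}_s\mathsf{E}^\tau(L)\\ \mathsf{E}^\kappa(L)\end{pmatrix},$$ with $\mathbf{c}_1,\mathbf{c}_2$ constant in $s$, where $\rho_{FS}=\left(\mathbf{x}_s\;\;\tfrac{\mathbf{x}_{ss}}{\kappa}\;\;\tfrac{\mathbf{x}_s\times\mathbf{x}_{ss}}{\kappa}\right)$ (columns), $D=\mathrm{diag}(1,-1,1)$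 and $X=\begin{pmatrix}0&-z&y\\ z&0&-x\\ -y&x&0\end{pmatrix}$. This defines $\mathbf{c}_1$ and $\mathbf{c}_2$. *)

(* Defs.v *)
From HB Require Import structures.
From mathcomp Require Import all_boot all_order all_algebra.
From mathcomp Require Import all_classical all_reals all_analysis.

Set Implicit Arguments.
Unset Strict Implicit.
Unset Printing Implicit Defensive.

Import Order.TTheory GRing.Theory Num.Theory numFieldNormedType.Exports.

Local Open Scope ring_scope.
Local Open Scope classical_set_scope.

(** Smoothness on an open set [U].  For finite-dimensional [V], which is the only
    case used below, [Ck_on k U f] is the usual C^k: a Frechet differentiable
    map is C^(k+1) iff all its directional derivatives are C^k. *)
Fixpoint Ck_on (R : realType) (V W : normedModType R) (k : nat) (U : set V)
    (f : V -> W) : Prop :=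
  if k is k'.+1 then
    (forall p, U p -> differentiable f p) /\
    (forall v, Ck_on k' U (fun p => 'D_v f p))
  else forall p, U p -> {for p, continuous f}.

Definition smooth_on (R : realType) (V W : normedModType R) (U : set V)
    (f : V -> W) : Prop := forall k, Ck_on k U f.

(** Euclidean geometry of R^3.  The norm [`|u|] that the library puts on
    ['cV[R]_3] is the max norm, hence [enorm]. *)
Definition col3 (R : realType) (a b c : R) : 'cV[R]_3 :=
  \col_i [:: a; b; c]`_i.

Definition dotp (R : realType) (u v : 'cV[R]_3) : R := (u^T *m v) 0 0.

Definition enorm (R : realType) (u : 'cV[R]_3) : R := Num.sqrt (dotp u u).

Definition crossp (R : realType) (u v : 'cV[R]_3) : 'cV[R]_3 :=
  col3 (u 1 0 * v 2 0 - u 2 0 * v 1 0)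
       (u 2 0 * v 0 0 - u 0 0 * v 2 0)
       (u 0 0 * v 1 0 - u 1 0 * v 0 0).

(** In what follows [g : R -> 'cV_3] is a curve in an arbitrary regular
    parametrization, because a variation does not preserve arc length. *)
Definition speed (R : realType) (g : R -> 'cV[R]_3) (s : R) : R :=
  enorm (derive1 g s).

(** Derivative with respect to the arc length of [g]; it is plain d/ds wherever
    [g] has unit speed. *)
Definition arcD (R : realType) (g : R -> 'cV[R]_3) (f : R -> R) : R -> R :=
  fun s => derive1 f s / speed g s.

Definition curvature (R : realType) (g : R -> 'cV[R]_3) (s : R) : R :=
  enorm (crossp (derive1 g s) (derive1n 2 g s)) / enorm (derive1 g s) ^+ 3.

Definition torsion (R : realType) (g : R -> 'cV[R]_3) (s : R) : R :=
  dotp (derive1n 3 g s) (crossp (derive1 g s) (derive1n 2 g s))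
  / enorm (crossp (derive1 g s) (derive1n 2 g s)) ^+ 2.

Definition kappa_ (R : realType) (g : R -> 'cV[R]_3) (m : nat) : R -> R :=
  iter m (arcD g) (curvature g).

Definition tau_ (R : realType) (g : R -> 'cV[R]_3) (m : nat) : R -> R :=
  iter m (arcD g) (torsion g).

(** The arguments of a Lagrangian: a point [(k, t)] of this space stands for
    kappa = k 0 0, kappa_1 = k 0 1, ..., tau = t 0 0, tau_1 = t 0 1, ... *)
Notation jets R n := ('rV[R]_n.+1 * 'rV[R]_n.+1)%type.

Definition jet (R : realType) (n : nat) (g : R -> 'cV[R]_3) (s : R) :
    jets R n :=
  (\row_(m < n.+1) kappa_ g m s, \row_(m < n.+1) tau_ g m s).

Definition dL_kappa (R : realType) (n : nat) (L : jets R n -> R) (m : 'I_n.+1)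
    (p : jets R n) : R :=
  'D_((delta_mx 0 m : 'rV[R]_n.+1), (0 : 'rV[R]_n.+1)) L p.

Definition dL_tau (R : realType) (n : nat) (L : jets R n -> R) (m : 'I_n.+1)
    (p : jets R n) : R :=
  'D_((0 : 'rV[R]_n.+1), (delta_mx 0 m : 'rV[R]_n.+1)) L p.

Definition Euler_kappa (R : realType) (n : nat) (L : jets R n -> R)
    (g : R -> 'cV[R]_3) (s : R) : R :=
  \sum_(m < n.+1)
    (-1) ^+ m * iter m (arcD g) (fun r => dL_kappa L m (jet n g r)) s.

Definition Euler_tau (R : realType) (n : nat) (L : jets R n -> R)
    (g : R -> 'cV[R]_3) (s : R) : R :=
  \sum_(m < n.+1)
    (-1) ^+ m * iter m (arcD g) (fun r => dL_tau L m (jet n g r)) s.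

Definition lambda (R : realType) (n : nat) (L : jets R n -> R)
    (g : R -> 'cV[R]_3) (s : R) : R :=
  2 * torsion g s * Euler_tau L g s - L (jet n g s)
  + \sum_(m < n.+1 | (1 <= m)%N) \sum_(i < m)
      (-1) ^+ i * iter i (arcD g) (fun r => dL_kappa L m (jet n g r)) s
      * kappa_ g (m - i) s
  + \sum_(m < n.+1 | (1 <= m)%N) \sum_(i < m)
      (-1) ^+ i * iter i (arcD g) (fun r => dL_tau L m (jet n g r)) s
      * tau_ g (m - i) s.

(** The part over [a, b] of the functional, in an arbitrary parametrization:
    the arc length element of [g] is [speed g s] ds. *)
Definition action (R : realType) (n : nat) (L : jets R n -> R) (a b : R)
    (g : R -> 'cV[R]_3) : R :=
  \int[lebesgue_measure]_(s in `[a, b]) (L (jet n g s) * speed g s).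

(** [Y (e, s)] is a smooth one-parameter family of curves, |e| < d, through [x]
    at e = 0, that differs from [x] only on the compact subset [a, b] of [I]. *)
Definition curve_variation (R : realType) (I : set R) (x : R -> 'cV[R]_3)
    (d a b : R) (Y : R * R -> 'cV[R]_3) : Prop :=
  [/\ `[a, b] `<=` I,
      smooth_on [set p : R * R | `|p.1| < d /\ I p.2] Y,
      forall s, I s -> Y (0, s) = x s &
      forall e s, `|e| < d -> I s -> ~ (a <= s <= b) -> Y (e, s) = x s].

(** Only the part of the functional over [a, b] depends on [e], so its
    derivative is the first variation even when the integral over [I]
    diverges. *)
Definition extremal (R : realType) (n : nat) (L : jets R n -> R) (I : set R)
    (x : R -> 'cV[R]_3) : Prop :=
  forall (d a b : R) (Y : R * R -> 'cV[R]_3),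
    0 < d -> a <= b -> curve_variation I x d a b Y ->
    is_derive (0 : R) (1 : R)
      (fun e : R => action L a b (fun s => Y (e, s))) 0.

Definition rhoFS (R : realType) (x : R -> 'cV[R]_3) (s : R) : 'M[R]_3 :=
  \matrix_(i, j)
    [:: derive1 x s i 0;
        ((curvature x s)^-1 *: derive1n 2 x s) i 0;
        ((curvature x s)^-1 *: crossp (derive1 x s) (derive1n 2 x s)) i 0]`_j.

Definition Dmx (R : realType) : 'M[R]_3 := diag_mx (\row_j [:: 1; -1; 1]`_j).

Definition Xmx (R : realType) (u : 'cV[R]_3) : 'M[R]_3 :=
  \matrix_(i, j)
    (nth [::] [:: [:: 0; - u 2 0; u 1 0];
                  [:: u 2 0; 0; - u 0 0];
                  [:: - u 1 0; u 0 0; 0]] i)`_j.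

Definition upsilon (R : realType) (n : nat) (L : jets R n -> R)
    (x : R -> 'cV[R]_3) (s : R) : 'cV[R]_(3 + 3) :=
  let kappa := curvature x in
  let tau := torsion x in
  let Ds := arcD x in
  let Ek := Euler_kappa L x in
  let Et := Euler_tau L x in
  col_mx
    (col3
      (tau s * Et s - kappa s * Ek s - lambda L x s)
      (- Ds Ek s - tau s / kappa s * Ds Et s)
      ((kappa s)^-1 * Ds (Ds Et) s - Ds kappa s / kappa s ^+ 2 * Ds Et s
       + kappa s * Et s - tau s * Ek s))
    (col3
      (Et s)
      (- (kappa s)^-1 * Ds Et s)
      (Ek s)).

Definition noether_laws (R : realType) (n : nat) (L : jets R n -> R)
    (I : set R) (x : R -> 'cV[R]_3) (c1 c2 : 'cV[R]_3) : Prop :=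
  forall s, I s ->
    block_mx (rhoFS x s) 0
             (Dmx R *m Xmx (x s) *m rhoFS x s) (Dmx R *m rhoFS x s *m Dmx R)
    *m upsilon L x s = col_mx c1 c2.

(* Main.v *)
(** Let T, N, B be the Frenet frame and F = F1 T + F2 N + F3 B the vector whose
    coordinates are the first three entries of upsilon(I). The first variation of
    the action along x + e phi c, with phi a bump function and c a constant
    vector, is the integral of phi' (F . c): integrating the variations of the
    kappa_m and tau_m by parts produces the Euler operators, the commutator of
    d/de with the arc length derivative produces lambda, and everything else is
    the derivative of a flux supported in the support of phi. Hence F is constant
    on an extremal; it is c_1. The Frenet equations alone then show that the
    torque (x cross F) + E^tau T + (D_s E^tau / kappa) N + E^kappa B has
    derivative zero; up to the signs of D it is c_2. The two first integrals are
    F . F and F . torque. *)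
Require Import Defs.
From HB Require Import structures.
From mathcomp Require Import all_boot all_order all_algebra.
From mathcomp Require Import all_classical all_reals all_analysis.
From mathcomp Require Import ring lra.
Import Order.TTheory GRing.Theory Num.Theory numFieldNormedType.Exports.
Local Open Scope ring_scope.
Local Open Scope classical_set_scope.
Set Implicit Arguments.
Unset Strict Implicit.
Unset Printing Implicit Defensive.

(** * Smooth functions of one and of two real variables *)

(** Two obstacles shape the proof. The commutator of d/de with D_s rests on symmetry of mixed
    partials in (e, s). Speed, curvature and torsion of x + e phi c are built from [e] and smooth
    functions of [s] by sums, products, inverses and square roots, so the mixed partial can be
    written down explicitly and checked against both orders of differentiation. L is composed only
    afterwards, where first derivatives in [e] suffice. The other obstacle is that L lives on an
    open set of jets and that a varied curve may lose regularity, so all work takes place near the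
    line e = 0, and compactness of [a, b] provides one range of [e] for the whole segment. The bump
    enters only through derivatives because translations preserve kappa and tau. The flux is
    designed to remove its second and third derivatives, which leaves the factor phi'. The
    Euler-Lagrange equations are never written out: a zero derivative of F . c for every c stands in
    for them. *)

Section RealDerivatives.
Variable R : realType.
Implicit Types (f g u : R -> R) (x a b : R).

(** Pointwise forms, with products in place of scalar actions: derivatives of long expressions can
    then be assembled as terms, and the leftover identity goes to [ring] or [field]. *)
Lemma is_derive_add f g x a b :
  is_derive x 1 f a -> is_derive x 1 g b ->
  is_derive x 1 (fun t => f t + g t) (a + b).
Proof. by move=> df dg; exact: is_deriveD. Qed.

Lemma is_derive_mul f g x a b :
  is_derive x 1 f a -> is_derive x 1 g b ->
  is_derive x 1 (fun t => f t * g t) (f x * b + g x * a).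
Proof. by move=> df dg; exact: is_deriveM. Qed.

Lemma is_derive_inv f x a : f x != 0 ->
  is_derive x 1 f a -> is_derive x 1 (fun t => (f t)^-1) (- a * (f x)^-1 * (f x)^-1).
Proof.
move=> fx0 [df <-]; apply: DeriveDef; first exact: derivableV.
by rewrite deriveV // /GRing.scale /= expr2 invfM; ring.
Qed.

Lemma is_derive_sqrt f x a : 0 < f x ->
  is_derive x 1 f a ->
  is_derive x 1 (fun t => Num.sqrt (f t)) (a * 2^-1 * (Num.sqrt (f x))^-1).
Proof.
move=> fx0 df.
apply: (is_derive_eq (is_derive1_comp (is_derive1_sqrt fx0) df)).
by rewrite invfM; ring.
Qed.

Lemma is_derive_unique f x a b :
  is_derive x 1 f a -> is_derive x 1 f b -> a = b.
Proof. by move=> [_ <-] [_ <-]. Qed.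

Lemma is_derive1E f x a : is_derive x 1 f a -> derive1 f x = a.
Proof. by move=> [_ <-]; rewrite derive1E. Qed.

Lemma derivable_is_derive1 f x : derivable f x 1 -> is_derive x 1 f (derive1 f x).
Proof. by move=> df; rewrite derive1E; exact: derivableP. Qed.

End RealDerivatives.

Section Smooth1.
Variables (R : realType) (I : set R).
Hypothesis I_open : open I.

(** Continuity of the derivatives need not be demanded, since each of them is again derivable. *)
Record smooth1 (u : R -> R) : Prop := Smooth1 {
  smooth1_derivable : forall k s, I s -> derivable (derive1n k u) s 1 }.

Lemma derive1_eq_on (u v : R -> R) :
  (forall s, I s -> u s = v s) -> forall s, I s -> derive1 u s = derive1 v s.
Proof.
move=> uv s Is; rewrite !derive1E; apply: near_eq_derive.
by move/open_nbhs_nbhs: (conj I_open Is) => /(filterS uv).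
Qed.

Lemma derivable_eq_on (u v : R -> R) s :
  (forall s, I s -> u s = v s) -> I s -> derivable u s 1 -> derivable v s 1.
Proof.
move=> uv Is; apply: near_eq_derivable.
by move/open_nbhs_nbhs: (conj I_open Is) => /(filterS uv).
Qed.

Lemma derive1n_eq_on (u v : R -> R) k :
  (forall s, I s -> u s = v s) -> forall s, I s -> derive1n k u s = derive1n k v s.
Proof.
move=> uv; elim: k => [|k IHk] //= s Is.
exact: derive1_eq_on IHk s Is.
Qed.

Lemma smooth1_eq (u v : R -> R) :
  (forall s, I s -> u s = v s) -> smooth1 u -> smooth1 v.
Proof.
move=> uv [su]; split=> k s Is; have := su k s Is.
by apply: derivable_eq_on => // t It; exact: derive1n_eq_on.
Qed.

Lemma smooth1_derive (u : R -> R) : smooth1 u -> smooth1 (derive1 u).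
Proof. by move=> [su]; split=> k s Is; rewrite -derive1Sn; exact: su. Qed.

Lemma smooth1_derive1n (u : R -> R) k : smooth1 u -> smooth1 (derive1n k u).
Proof. move=> su; elim: k => [|k IHk]; first exact: su.
by rewrite derive1nS; exact: smooth1_derive. Qed.

Lemma smooth1_is_derive (u : R -> R) s :
  smooth1 u -> I s -> is_derive s 1 u (derive1 u s).
Proof. by move=> su Is; apply: derivable_is_derive1; exact: (smooth1_derivable (k := 0%N) su). Qed.

Lemma smooth1_continuous (u : R -> R) s : smooth1 u -> I s -> {for s, continuous u}.
Proof.
move=> su Is; apply: differentiable_continuous.
by apply/derivable1_diffP; exact: (smooth1_derivable (k := 0%N) su).
Qed.

Lemma smooth1_cst (c : R) : smooth1 (cst c).
Proof.
split=> k s _; suff [d ->] : exists d, derive1n k (cst c : R -> R) = cst d.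
  exact: derivable_cst.
elim: k => [|k [d IHk]]; first by exists c.
by exists 0; rewrite derive1nS IHk; apply/funext => t; rewrite derive1_cst.
Qed.

End Smooth1.

Section Smooth2.
Variables (R : realType) (n : nat).
Local Notation RR := (R * R)%type.

(* The smallest class of functions of (e, s) closed under the operations that
   build the curvatures of a varied curve. The flag [b] admits composition with
   a smooth function of the jet; then symmetry of mixed partials is not claimed,
   because it would need Schwarz' theorem for that function. *)
Inductive smooth2 (b : bool) (W : set RR) : (RR -> R) -> Prop :=
| smooth2_base I u : open I -> smooth1 I u -> (forall p, W p -> I p.2) ->
    smooth2 b W (fun p => u p.2)
| smooth2_fst : smooth2 b W fst
| smooth2_add f g : smooth2 b W f -> smooth2 b W g ->
    smooth2 b W (fun p => f p + g p)
| smooth2_mul f g : smooth2 b W f -> smooth2 b W g ->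
    smooth2 b W (fun p => f p * g p)
| smooth2_inv f : smooth2 b W f -> (forall p, W p -> f p != 0) ->
    smooth2 b W (fun p => (f p)^-1)
| smooth2_sqrt f : smooth2 b W f -> (forall p, W p -> 0 < f p) ->
    smooth2 b W (fun p => Num.sqrt (f p))
| smooth2_comp (U : set (jets R n)) (G : jets R n -> R)
    (f g : 'I_n.+1 -> RR -> R) : b -> smooth_on U G ->
    (forall i, smooth2 b W (f i)) -> (forall i, smooth2 b W (g i)) ->
    (forall p, W p -> U (\row_i f i p, \row_i g i p)) ->
    smooth2 b W (fun p => G (\row_i f i p, \row_i g i p))
| smooth2_eq f g : smooth2 b W f -> (forall p, W p -> f p = g p) ->
    smooth2 b W g.

Lemma smooth2_cst b W (c : R) : smooth2 b W (fun=> c).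
Proof. by apply: (@smooth2_base b W setT (fun=> c)) => //; [exact: openT|exact: smooth1_cst]. Qed.

Lemma smooth2_opp b W f : smooth2 b W f -> smooth2 b W (fun p => - f p).
Proof.
move=> sf; apply: smooth2_eq (smooth2_mul (smooth2_cst b W (-1)) sf) _.
by move=> p _; rewrite mulN1r.
Qed.

Lemma smooth2_sum b W (T : Type) (r : seq T) (P : pred T) (F : T -> RR -> R) :
  (forall i, smooth2 b W (F i)) -> smooth2 b W (fun p => \sum_(i <- r | P i) F i p).
Proof.
move=> sF; elim: r => [|i r IHr].
  by apply: smooth2_eq (smooth2_cst b W 0) _ => p _; rewrite big_nil.
have [Pi|NPi] := boolP (P i).
  by apply: smooth2_eq (smooth2_add (sF i) IHr) _ => p _; rewrite big_cons Pi.
by apply: smooth2_eq IHr _ => p _; rewrite big_cons (negbTE NPi).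
Qed.

Lemma Ck_on_pred (V W : normedModType R) k (U : set V) (f : V -> W) :
  Ck_on k.+1 U f -> Ck_on k U f.
Proof.
elim: k f => [|k IHk] f [df Df].
  by move=> p Up; apply: differentiable_continuous; exact: df.
by split=> // v; apply: IHk; exact: Df.
Qed.

Lemma smooth_on_derive (V W : normedModType R) (U : set V) (f : V -> W) v :
  smooth_on U f -> smooth_on U (fun p => 'D_v f p).
Proof. by move=> sf k; have [_] := sf k.+1; apply. Qed.

Lemma smooth_on_differentiable (V W : normedModType R) (U : set V) (f : V -> W) p :
  smooth_on U f -> U p -> differentiable f p.
Proof. by move=> sf Up; case: (sf 1%N) => df _; exact: df. Qed.

Let rvn := 'rV[R]_n.+1.

Lemma row_continuous (T : topologicalType) (f : 'I_n.+1 -> T -> R) (t : T) :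
  (forall i, {for t, continuous (f i)}) ->
  {for t, continuous (fun t => \row_i f i t : rvn)}.
Proof.
move=> cf; apply/cvgrPdist_le => /= e e0; near=> u.
rewrite /Num.Def.normr/= mx_normrE (bigmax_le _ (ltW e0))//= => -[i j] _.
rewrite !mxE/=; move: j; near: u; apply: filter_forall => j.
exact: ((cvgrPdist_le _ _).1 (cf j)).
Unshelve. all: by end_near. Qed.

Lemma row_is_derive (f : 'I_n.+1 -> R -> R) (df : 'I_n.+1 -> R) (t : R) :
  (forall i, is_derive t 1 (f i) (df i)) ->
  is_derive t 1 (fun t => \row_i f i t : rvn) (\row_i df i).
Proof.
move=> ff.
have d : derivable (fun t => \row_i f i t : rvn) t 1.
  apply/derivable_mxP => i j; under eq_fun do rewrite mxE.
  exact: (ff j).(ex_derive).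
apply: DeriveDef => //; rewrite derive_mx//; apply/matrixP => i j.
rewrite !mxE; under eq_fun do rewrite mxE.
exact: derive_val.
Qed.

(** The differential of [G] is applied to the velocity of the pair of rows, which is expanded along
    the basis directions that define [dL_kappa] and [dL_tau]. *)
Lemma jet_chain_rule (G : jets R n -> R) (f g : 'I_n.+1 -> R -> R)
    (df dg : 'I_n.+1 -> R) (t : R) :
  differentiable G (\row_i f i t, \row_i g i t) ->
  (forall i, is_derive t 1 (f i) (df i)) ->
  (forall i, is_derive t 1 (g i) (dg i)) ->
  is_derive t 1 (fun t => G (\row_i f i t, \row_i g i t))
   (\sum_i df i * dL_kappa G i (\row_i f i t, \row_i g i t)
    + \sum_i dg i * dL_tau G i (\row_i f i t, \row_i g i t)).
Proof.
move=> dG ff gg.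
set q := (_, _) in dG *.
have [df1 df2] := row_is_derive ff.
have [dg1 dg2] := row_is_derive gg.
have d1 := (derivable1_diffP _ _).1 df1.
have d2 := (derivable1_diffP _ _).1 dg1.
have d12 := differentiable_pair d1 d2.
have dGc : differentiable (G \o (fun t => (\row_i f i t : rvn, \row_i g i t : rvn))) t.
  exact: differentiable_comp.
apply: DeriveDef; first exact/derivable1_diffP.
rewrite (deriveE (f := G \o (fun t => (\row_i f i t : rvn, \row_i g i t : rvn)))) //.
have -> : 'd (G \o (fun t => (\row_i f i t : rvn, \row_i g i t : rvn))) t 1 =
    'd G q (\row_i df i : rvn, \row_i dg i : rvn).
  rewrite (diff_comp d12 dG) [LHS]/comp (diff_pair d1 d2).
  have e1 := deriveE (1 : R^o) d1; have e2 := deriveE (1 : R^o) d2.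
  rewrite df2 in e1; rewrite dg2 in e2.
  exact: (f_equal2 (fun a b => 'd G q (a, b)) (esym e1) (esym e2)).
have -> : (\row_i df i : rvn, \row_i dg i : rvn) =
    \sum_i df i *: (delta_mx 0 i : rvn, 0 : rvn)
    + \sum_i dg i *: (0 : rvn, delta_mx 0 i : rvn).
  apply/eqP; rewrite xpair_eqE; apply/andP; split; apply/eqP.
    rewrite [RHS]/= -[RHS]/((_ + _).1) raddfD !raddf_sum /=.
    rewrite [X in _ + X]big1 ?addr0; last by move=> i _; rewrite scaler0.
    by rewrite [LHS]row_sum_delta; apply: eq_bigr => i _; rewrite mxE.
  rewrite [RHS]/= -[RHS]/((_ + _).2) raddfD !raddf_sum /=.
  rewrite [X in X + _]big1 ?add0r; last by move=> i _; rewrite scaler0.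
  by rewrite [LHS]row_sum_delta; apply: eq_bigr => i _; rewrite mxE.
rewrite raddfD !raddf_sum; congr (_ + _); apply: eq_bigr => i _;
  rewrite /dL_kappa /dL_tau (deriveE _ dG);
  pose G' : {linear (rvn * rvn)%type -> R^o} := 'd G q;
  exact: (linearZ_LR G').
Qed.

End Smooth2.

Section Smooth2Theory.
Variables (R : realType) (n : nat) (b : bool) (W : set (R * R)).
Hypothesis W_open : open W.
Local Notation RR := (R * R)%type.
Local Notation sm := (@smooth2 R n b W).

Definition partial_e (f : RR -> R) (p : RR) : R := derive1 (fun e => f (e, p.2)) p.1.
Definition partial_s (f : RR -> R) (p : RR) : R := derive1 (fun s => f (p.1, s)) p.2.

Lemma near_slice_e (P : RR -> Prop) p : W p -> (forall q, W q -> P q) ->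
  \forall e \near p.1, P (e, p.2).
Proof.
move=> Wp WP; have c : (fun e => (e, p.2)) @ p.1 --> p.
  by case: p {Wp} => p1 p2 /=; apply: (@cvg_pair _ _ _ _ (nbhs _)); [exact: cvg_id|exact: cvg_cst].
have H : nbhs p.1 (fun e => W (e, p.2)) := c W (open_nbhs_nbhs (conj W_open Wp)).
by move: H; apply: filterS => e; exact: WP.
Qed.

Lemma near_slice_s (P : RR -> Prop) p : W p -> (forall q, W q -> P q) ->
  \forall s \near p.2, P (p.1, s).
Proof.
move=> Wp WP; have c : (fun s => (p.1, s)) @ p.2 --> p.
  by case: p {Wp} => p1 p2 /=; apply: (@cvg_pair _ _ _ _ (nbhs _)); [exact: cvg_cst|exact: cvg_id].
have H : nbhs p.2 (fun s => W (p.1, s)) := c W (open_nbhs_nbhs (conj W_open Wp)).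
by move: H; apply: filterS => s; exact: WP.
Qed.

Lemma smooth2_continuous f p : sm f -> W p -> {for p, continuous f}.
Proof.
move=> sf; elim: sf p => {f}.
- move=> I u _ su WI p Wp.
  by apply: continuous_comp; [exact: cvg_snd|exact: (smooth1_continuous su (WI _ Wp))].
- by move=> p _; exact: cvg_fst.
- by move=> f g _ cf _ cg p Wp; apply: cvgD; [exact: cf|exact: cg].
- by move=> f g _ cf _ cg p Wp; apply: cvgM; [exact: cf|exact: cg].
- by move=> f _ cf f0 p Wp; apply: cvgV; [exact: f0|exact: cf].
- move=> f _ cf f0 p Wp; apply: (continuous_comp (cf p Wp)).
  exact: sqrt_continuous.
- move=> U G f g _ sG _ cf _ cg WU p Wp.
  have cG : {for (\row_i f i p, \row_i g i p), continuous G}.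
    by apply: differentiable_continuous; exact: smooth_on_differentiable sG (WU _ Wp).
  pose rf p := \row_i f i p : 'rV[R]_n.+1; pose rg p := \row_i g i p : 'rV[R]_n.+1.
  have cr : rf p @[p --> p] --> rf p by apply: row_continuous => i; exact: cf.
  have cs : rg p @[p --> p] --> rg p by apply: row_continuous => i; exact: cg.
  have c : {for p, continuous (fun p => (rf p, rg p) : jets R n)}.
    exact: (cvg_pair cr cs).
  exact: (continuous_comp c cG).
- move=> f g _ cf fg p Wp.
  suff : g x @[x --> p] --> f p by rewrite (fg _ Wp).
  apply: cvg_trans (cf p Wp); apply: near_eq_cvg.
  by move/open_nbhs_nbhs: (conj W_open Wp) => /(filterS fg).
Qed.

Definition is_partial_e (f fe : RR -> R) := forall p, W p ->
  is_derive p.1 1 (fun e => f (e, p.2)) (fe p).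
Definition is_partial_s (f fs : RR -> R) := forall p, W p ->
  is_derive p.2 1 (fun s => f (p.1, s)) (fs p).

Lemma smooth2_partials f : sm f -> exists fe fs m : RR -> R,
  [/\ sm fe, sm fs, is_partial_e f fe, is_partial_s f fs &
      ~~ b -> is_partial_s fe m /\ is_partial_e fs m].
Proof.
elim => {f}.
- move=> I u I_open su WI.
  exists (fun=> 0), (fun p => derive1 u p.2), (fun=> 0); split.
  + exact: smooth2_cst.
  + by apply: (@smooth2_base _ _ _ _ I (derive1 u)) ; [by []|exact: smooth1_derive|by []].
  + by move=> p _; exact: (is_derive_cst (u p.2)).
  + by move=> p Wp; apply: smooth1_is_derive su (WI _ Wp).
  + move=> _; split => p _; first exact: is_derive_cst.
    exact: (is_derive_cst (derive1 u p.2)).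
- exists (fun=> 1), (fun=> 0), (fun=> 0); split; do ?[exact: smooth2_cst].
  + by move=> p _; exact: is_derive_id.
  + by move=> p _; exact: is_derive_cst.
  + by move=> _; split => p _ /=; exact: is_derive_cst.
- move=> f g sf [fe [fs [fm [sfe sfs pfe pfs pfm]]]] sg [ge [gs [gm [sge sgs pge pgs pgm]]]].
  exists (fun p => fe p + ge p), (fun p => fs p + gs p), (fun p => fm p + gm p).
  split; do ?[exact: smooth2_add].
  + by move=> p Wp; apply: is_derive_add; [exact: pfe|exact: pge].
  + by move=> p Wp; apply: is_derive_add; [exact: pfs|exact: pgs].
  + move=> nb; have [pf1 pf2] := pfm nb; have [pg1 pg2] := pgm nb.
    split=> p Wp; apply: is_derive_add;
    by [exact: pf1|exact: pg1|exact: pf2|exact: pg2].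
- move=> f g sf [fe [fs [fm [sfe sfs pfe pfs pfm]]]] sg [ge [gs [gm [sge sgs pge pgs pgm]]]].
  exists (fun p => f p * ge p + g p * fe p), (fun p => f p * gs p + g p * fs p),
    (fun p => f p * gm p + ge p * fs p + (g p * fm p + fe p * gs p)).
  split; do ?[by apply: smooth2_add; apply: smooth2_mul].
  + by move=> [p1 p2] Wp; apply: is_derive_mul; [exact: (pfe (_, _))|exact: (pge (_, _))].
  + by move=> [p1 p2] Wp; apply: is_derive_mul; [exact: (pfs (_, _))|exact: (pgs (_, _))].
  + move=> nb; have [pf1 pf2] := pfm nb; have [pg1 pg2] := pgm nb.
    split; move=> [p1 p2] Wp.
      by apply: is_derive_add; apply: is_derive_mul;
      [exact: (pfs (_, _))|exact: (pg1 (_, _))|exact: (pgs (_, _))|exact: (pf1 (_, _))].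
    (* The same [m], regrouped into the shape that the product rule in [e] gives for the
       [s]-partial. *)
    have -> : f (p1, p2) * gm (p1, p2) + ge (p1, p2) * fs (p1, p2) +
        (g (p1, p2) * fm (p1, p2) + fe (p1, p2) * gs (p1, p2)) =
      (f (p1, p2) * gm (p1, p2) + gs (p1, p2) * fe (p1, p2)) +
        (g (p1, p2) * fm (p1, p2) + fs (p1, p2) * ge (p1, p2)) by ring.
    by apply: is_derive_add; apply: is_derive_mul;
      [exact: (pfe (_, _))|exact: (pg2 (_, _))|exact: (pge (_, _))|exact: (pf2 (_, _))].
- move=> f sf [fe [fs [fm [sfe sfs pfe pfs pfm]]]] f0.
  have sV := smooth2_inv sf f0.
  pose m p := - fe p * (f p)^-1 * (- fs p * (f p)^-1 * (f p)^-1) +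
     (f p)^-1 * (- fe p * (- fs p * (f p)^-1 * (f p)^-1) + (f p)^-1 * (- fm p)).
  exists (fun p => - fe p * (f p)^-1 * (f p)^-1),
    (fun p => - fs p * (f p)^-1 * (f p)^-1), m.
  have smx h : sm h -> sm (fun p => - h p * (f p)^-1 * (f p)^-1).
    by move=> sh; do 2![apply: smooth2_mul => //]; exact: smooth2_opp.
  split; do ?[exact: smx].
  + by move=> [p1 p2] Wp; apply: is_derive_inv; [exact: f0|exact: (pfe (_, _))].
  + by move=> [p1 p2] Wp; apply: is_derive_inv; [exact: f0|exact: (pfs (_, _))].
  + move=> nb; have [pf1 pf2] := pfm nb; split; move=> [p1 p2] Wp.
      have di := is_derive_inv (f0 _ Wp) (pfs _ Wp).
      apply: is_derive_mul => //; apply: is_derive_mul => //.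
      exact: (is_deriveN (pf1 _ Wp)).
    have di := is_derive_inv (f0 _ Wp) (pfe _ Wp).
    rewrite (_ : m _ = - fs (p1, p2) * (f (p1, p2))^-1 *
       (- fe (p1, p2) * (f (p1, p2))^-1 * (f (p1, p2))^-1) +
     (f (p1, p2))^-1 * (- fs (p1, p2) * (- fe (p1, p2) * (f (p1, p2))^-1 *
       (f (p1, p2))^-1) + (f (p1, p2))^-1 * (- fm (p1, p2)))); last by rewrite /m; ring.
    apply: is_derive_mul => //; apply: is_derive_mul => //.
    exact: (is_deriveN (pf2 _ Wp)).
- move=> f sf [fe [fs [fm [sfe sfs pfe pfs pfm]]]] f0.
  have sS := smooth2_sqrt sf f0.
  have q0 p : W p -> Num.sqrt (f p) != 0 by move=> Wp; rewrite gt_eqF // sqrtr_gt0 f0.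
  have sV := smooth2_inv sS q0.
  pose ds g p := g p * 2^-1 * (Num.sqrt (f p))^-1.
  pose dd g h p := g p * 2^-1 * (- (ds h p) * (Num.sqrt (f p))^-1 * (Num.sqrt (f p))^-1)
     + (Num.sqrt (f p))^-1 * (g p * 0 + 2^-1 * fm p).
  exists (ds fe), (ds fs), (dd fe fs).
  have smx h : sm h -> sm (ds h).
    by move=> sh; do 2![apply: smooth2_mul => //]; exact: smooth2_cst.
  split; do ?[exact: smx].
  + by move=> [p1 p2] Wp; apply: is_derive_sqrt; [exact: f0|exact: (pfe (_, _))].
  + by move=> [p1 p2] Wp; apply: is_derive_sqrt; [exact: f0|exact: (pfs (_, _))].
  + move=> nb; have [pf1 pf2] := pfm nb; split; move=> [p1 p2] Wp.
      have di := is_derive_inv (f := fun s => Num.sqrt (f (p1, s))) (q0 _ Wp)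
        (is_derive_sqrt (f0 _ Wp) (pfs _ Wp)).
      apply: is_derive_mul => //; apply: is_derive_mul => //.
      exact: (pf1 _ Wp).
    have di := is_derive_inv (f := fun e => Num.sqrt (f (e, p2))) (q0 _ Wp)
      (is_derive_sqrt (f0 _ Wp) (pfe _ Wp)).
    rewrite (_ : dd fe fs _ = dd fs fe (p1, p2)); last by rewrite /dd /ds; ring.
    apply: is_derive_mul => //; apply: is_derive_mul => //.
    exact: (pf2 _ Wp).
- move=> U G f g bT sG sf IHf sg IHg WU.
  have /choice[fd /all_and5[]] : forall i, exists d : (RR -> R) * (RR -> R),
      [/\ sm d.1, sm d.2, is_partial_e (f i) d.1, is_partial_s (f i) d.2 & True].
    by move=> i; have [fe [fs [fm []]]] := IHf i; exists (fe, fs).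
  move=> sfe sfs pfe pfs _.
  have /choice[gd /all_and5[]] : forall i, exists d : (RR -> R) * (RR -> R),
      [/\ sm d.1, sm d.2, is_partial_e (g i) d.1, is_partial_s (g i) d.2 & True].
    by move=> i; have [ge [gs [gm []]]] := IHg i; exists (ge, gs).
  move=> sge sgs pge pgs _.
  pose j p := (\row_i f i p, \row_i g i p) : jets R n.
  pose dG (h k : 'I_n.+1 -> RR -> R) p :=
    \sum_i h i p * dL_kappa G i (j p) + \sum_i k i p * dL_tau G i (j p).
  have sdG h k : (forall i, sm (h i)) -> (forall i, sm (k i)) -> sm (dG h k).
    move=> sh sk; apply: smooth2_add; apply: smooth2_sum => i; apply: smooth2_mul => //.
      by apply: (smooth2_comp (U := U) (G := dL_kappa G i)) => //; exact: smooth_on_derive.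
    by apply: (smooth2_comp (U := U) (G := dL_tau G i)) => //; exact: smooth_on_derive.
  (* The third witness is a dummy: [b] holds for this constructor, so nothing is claimed about mixed
     partials. *)
  exists (dG (fun i => (fd i).1) (fun i => (gd i).1)),
    (dG (fun i => (fd i).2) (fun i => (gd i).2)), (fun=> 0); split; do ?[exact: sdG].
  + move=> [p1 p2] Wp; apply: jet_chain_rule => [|i|i].
    * exact: smooth_on_differentiable sG (WU _ Wp).
    * exact: (pfe i _ Wp).
    * exact: (pge i _ Wp).
  + move=> [p1 p2] Wp; apply: jet_chain_rule => [|i|i].
    * exact: smooth_on_differentiable sG (WU _ Wp).
    * exact: (pfs i _ Wp).
    * exact: (pgs i _ Wp).
  + by rewrite bT.
- move=> f g sf [fe [fs [fm [sfe sfs pfe pfs pfm]]]] fg.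
  exists fe, fs, fm; split => //.
  + move=> p Wp; apply: near_eq_is_derive (pfe p Wp).
    exact: (near_slice_e (P := fun q => f q = g q)).
  + move=> p Wp; apply: near_eq_is_derive (pfs p Wp).
    exact: (near_slice_s (P := fun q => f q = g q)).
Qed.

Lemma smooth2_is_derive_e f p : sm f -> W p ->
  is_derive p.1 1 (fun e => f (e, p.2)) (partial_e f p).
Proof.
move=> sf Wp; have [fe [fs [m [_ _ pe _ _]]]] := smooth2_partials sf.
by rewrite /partial_e (is_derive1E (pe p Wp)); exact: pe.
Qed.

Lemma smooth2_is_derive_s f p : sm f -> W p ->
  is_derive p.2 1 (fun s => f (p.1, s)) (partial_s f p).
Proof.
move=> sf Wp; have [fe [fs [m [_ _ _ ps _]]]] := smooth2_partials sf.
by rewrite /partial_s (is_derive1E (ps p Wp)); exact: ps.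
Qed.

Lemma smooth2_partial_e f : sm f -> sm (partial_e f).
Proof.
move=> sf; have [fe [fs [m [sfe _ pe _ _]]]] := smooth2_partials sf.
by apply: smooth2_eq sfe _ => p Wp; rewrite -(is_derive1E (pe p Wp)).
Qed.

Lemma smooth2_partial_s f : sm f -> sm (partial_s f).
Proof.
move=> sf; have [fe [fs [m [_ sfs _ ps _]]]] := smooth2_partials sf.
by apply: smooth2_eq sfs _ => p Wp; rewrite -(is_derive1E (ps p Wp)).
Qed.

(** Both sides equal the explicit [m]. The chosen partials agree with [partial_e f] and
    [partial_s f] on the open set [W], which is enough to differentiate them once more. *)
Lemma smooth2_mixed f p : ~~ b -> sm f -> W p ->
  partial_e (partial_s f) p = partial_s (partial_e f) p.
Proof.
move=> nb sf Wp; have [fe [fs [m [_ _ pe ps /(_ nb)[m1 m2]]]]] := smooth2_partials sf.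
transitivity (m p).
  apply: is_derive1E; apply: near_eq_is_derive (m2 p Wp).
  apply: (near_slice_e (P := fun q => fs q = partial_s f q)) => // q Wq.
  by rewrite -(is_derive1E (ps q Wq)).
apply/esym/is_derive1E; apply: near_eq_is_derive (m1 p Wp).
apply: (near_slice_s (P := fun q => fe q = partial_e f q)) => // q Wq.
by rewrite -(is_derive1E (pe q Wq)).
Qed.

(** The k-th derivative of the slice is the slice of the k-fold [partial_s], which never leaves the
    class. *)
Lemma smooth2_slice (I : set R) f e0 : open I -> sm f ->
  (forall s, I s -> W (e0, s)) -> smooth1 I (fun s => f (e0, s)).
Proof.
move=> I_open sf IW.
have H k : exists g, sm g /\
    forall s, I s -> derive1n k (fun s => f (e0, s)) s = g (e0, s).
  elim: k => [|k [g [sg kg]]]; first by exists f.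
  exists (partial_s g); split; first exact: smooth2_partial_s.
  by move=> s Is; rewrite derive1nS (derive1_eq_on I_open kg Is).
split=> k s Is; have [g [sg kg]] := H k.
have dg : derivable (fun t => g (e0, t)) s 1 :=
  (smooth2_is_derive_s sg (IW s Is)).(ex_derive).
by apply: (derivable_eq_on I_open _ Is dg) => t It; rewrite kg.
Qed.

End Smooth2Theory.

Section Smooth1Algebra.
Variables (R : realType) (I : set R).
Hypothesis I_open : open I.

(** Functions of [s] alone are regarded as functions of (e, s) over the cylinder, so that the
    algebra of [smooth1] is read off the constructors of [smooth2]; the parameters [0] and [false]
    used for this are arbitrary. *)
Definition cylinder := [set p : R * R | I p.2].

Lemma open_cylinder : open cylinder.
Proof. by apply: open_comp => // p _; exact: cvg_snd. Qed.

Lemma smooth1_smooth2 n b u : smooth1 I u -> @smooth2 R n b cylinder (fun p => u p.2).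
Proof. by move=> su; apply: (@smooth2_base R n b cylinder I u). Qed.

Lemma smooth2_smooth1 n b u : @smooth2 R n b cylinder (fun p => u p.2) -> smooth1 I u.
Proof. by move=> su; exact: (smooth2_slice open_cylinder (e0 := 0) I_open su). Qed.

Lemma smooth1_add u v : smooth1 I u -> smooth1 I v -> smooth1 I (fun s => u s + v s).
Proof.
move=> su sv; apply: (@smooth2_smooth1 0 false).
by apply: smooth2_add; exact: smooth1_smooth2.
Qed.

Lemma smooth1_mul u v : smooth1 I u -> smooth1 I v -> smooth1 I (fun s => u s * v s).
Proof.
move=> su sv; apply: (@smooth2_smooth1 0 false).
by apply: smooth2_mul; exact: smooth1_smooth2.
Qed.

Lemma smooth1_opp u : smooth1 I u -> smooth1 I (fun s => - u s).
Proof.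
move=> su; apply: (@smooth2_smooth1 0 false).
by apply: smooth2_opp; exact: smooth1_smooth2.
Qed.

Lemma smooth1_inv u : (forall s, I s -> u s != 0) -> smooth1 I u ->
  smooth1 I (fun s => (u s)^-1).
Proof.
move=> u0 su; apply: (@smooth2_smooth1 0 false).
by apply: smooth2_inv; [exact: smooth1_smooth2|move=> p; exact: u0].
Qed.

Lemma smooth1_sum (T : Type) (r : seq T) (P : pred T) (F : T -> R -> R) :
  (forall i, smooth1 I (F i)) -> smooth1 I (fun s => \sum_(i <- r | P i) F i s).
Proof.
move=> sF; apply: (@smooth2_smooth1 0 false).
by apply: (smooth2_sum _ _ (F := fun i p => F i p.2)) => i; exact: smooth1_smooth2.
Qed.

End Smooth1Algebra.

(** * Closure properties of C^k maps, and their link with smoothness of coordinates *)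

Section CkClosure.
Variable R : realType.
Implicit Types V W : normedModType R.

(** The differential of [f] at [p] satisfies the little-o estimate for [g] as well, and uniqueness
    of the differential identifies it as that of [g]. *)
Lemma near_eq_differentiable V W (f g : V -> W) p :
  (\near p, f p = g p) -> differentiable f p -> differentiable g p.
Proof.
move=> fg df; have gp : g p = f p by exact/esym/(nbhs_singleton fg).
pose L : {linear V -> W} := 'd f p.
have dg : g \o shift p = cst (g p) + L +o_ 0 id.
  apply/eqaddoP => eps eps0.
  have /eqaddoP/(_ eps eps0) := diff_locally df.
  have : \forall h \near 0, f (h + p) = g (h + p).
    by move: fg; rewrite (near_shift 0 p) /=; apply: filterS => h; rewrite /= subr0.
  apply: filterS2 => h fgh; congr (is_true (`|_| <= _)).
  by rewrite !fctE /= fgh gp.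
have Lc : continuous L by exact: diff_continuous.
have e := diff_unique Lc dg.
by apply/diff_locallyP; rewrite e.
Qed.

Lemma Ck_on_eq V W k (U : set V) (f g : V -> W) : open U ->
  (forall p, U p -> f p = g p) -> Ck_on k U f -> Ck_on k U g.
Proof.
move=> Uo; elim: k f g => [|k IHk] f g fg /=.
  move=> cf p Up; suff : g x @[x --> p] --> f p by rewrite (fg _ Up).
  apply: cvg_trans (cf p Up); apply: near_eq_cvg.
  by move/open_nbhs_nbhs: (conj Uo Up) => /(filterS fg).
have nfg p : U p -> \near p, f p = g p.
  by move=> Up; move/open_nbhs_nbhs: (conj Uo Up) => /(filterS fg).
move=> [df Df]; split=> [p Up|v].
  by apply: near_eq_differentiable (df p Up); exact: nfg.
apply: IHk (Df v) => p Up; apply: near_eq_derive; exact: nfg.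
Qed.

Lemma Ck_on_cst V W k (U : set V) (c : W) : Ck_on k U (fun _ : V => c).
Proof.
elim: k c => [|k IHk] c /=; first by move=> p _; exact: cvg_cst.
split=> [p _|v]; first exact: differentiable_cst.
have -> : (fun p => 'D_v (fun _ : V => c) p) = (fun _ => 0).
  by apply/funext => p; exact: derive_cst.
exact: IHk.
Qed.

Lemma Ck_on_add V W k (U : set V) (f g : V -> W) : open U ->
  Ck_on k U f -> Ck_on k U g -> Ck_on k U (fun p => f p + g p).
Proof.
move=> Uo; elim: k f g => [|k IHk] f g /=.
  by move=> cf cg p Up; apply: cvgD; [exact: cf|exact: cg].
move=> [df Df] [dg Dg]; split=> [p Up|v].
  by apply: differentiableD; [exact: df|exact: dg].
apply: (Ck_on_eq Uo _ (IHk _ _ (Df v) (Dg v))) => p Up.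
by rewrite -deriveD //; apply: diff_derivable; [exact: df|exact: dg].
Qed.

Lemma Ck_on_mul V k (U : set V) (f g : V -> R) : open U ->
  Ck_on k U f -> Ck_on k U g -> Ck_on k U (fun p => f p * g p).
Proof.
move=> Uo; elim: k f g => [|k IHk] f g.
  by move=> cf cg p Up; apply: cvgM; [exact: cf|exact: cg].
move=> sf sg; have [df Df] := sf; have [dg Dg] := sg; split=> [p Up|v].
  by apply: differentiableM; [exact: df|exact: dg].
apply: (Ck_on_eq Uo _ (Ck_on_add Uo (IHk _ _ (Ck_on_pred sf) (Dg v))
                                    (IHk _ _ (Ck_on_pred sg) (Df v)))) => p Up.
by rewrite deriveM //; apply: diff_derivable; [exact: df|exact: dg].
Qed.

Lemma Ck_on_scalel V W k (U : set V) (f : V -> R) (c : W) : open U ->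
  Ck_on k U f -> Ck_on k U (fun p => f p *: c).
Proof.
move=> Uo; elim: k f => [|k IHk] f.
  by move=> cf p Up; apply: (cvgZr_tmp (F := nbhs p)); exact: cf.
move=> [df Df]; split=> [p Up|v].
  by apply: differentiableZl; exact: df.
apply: (Ck_on_eq Uo _ (IHk _ (Df v))) => p Up.
rewrite !deriveE; [|by apply: differentiableZl; exact: df|exact: df].
by rewrite diffZl //; exact: df.
Qed.

Lemma Ck_on_snd V W (X : normedModType R) k (U : set (V * W)) (I : set W) (f : W -> X) : open U ->
  (forall p, U p -> I p.2) -> Ck_on k I f -> Ck_on k U (fun p => f p.2).
Proof.
move=> Uo UI; elim: k f => [|k IHk] f.
  move=> cf p Up; apply: continuous_comp; first exact: cvg_snd.
  exact: cf (UI _ Up).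
move=> [df Df].
have dsnd (p : V * W) : differentiable (snd : V * W -> W) p.
  by apply: linear_differentiable => q; exact: cvg_snd.
split=> [p Up|v].
  by apply: (differentiable_comp (dsnd p)); exact: df (UI _ Up).
apply: (Ck_on_eq Uo _ (IHk _ (Df v.2))) => p Up.
have dfp := df _ (UI _ Up).
rewrite (deriveE _ dfp) (deriveE (f := f \o snd)); last exact: differentiable_comp.
rewrite (diff_comp (dsnd p) dfp) /=; congr ('d f _ _).
by rewrite diff_lin // => q; exact: cvg_snd.
Qed.

Lemma Ck_on_fst k (U : set (R * R)) : Ck_on k U (fst : R * R -> R).
Proof.
have dfst (p : R * R) : differentiable (fst : R * R -> R) p.
  by apply: linear_differentiable => q; exact: cvg_fst.
case: k => [|k]; first by move=> p _; exact: cvg_fst.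
split=> [p _|v]; first exact: dfst.
have -> : (fun p => 'D_v (fst : R * R -> R) p) = (fun _ => v.1).
  apply/funext => p; rewrite deriveE //.
  by rewrite diff_lin // => q; exact: cvg_fst.
exact: Ck_on_cst.
Qed.

Lemma smooth1_smooth_on (I : set R) (u : R -> R) : open I ->
  smooth1 I u -> smooth_on I u.
Proof.
move=> Io su k; elim: k u su => [|k IHk] u su.
  by move=> s; exact: smooth1_continuous.
split=> [s Is|v]; first by apply/derivable1_diffP; exact: (smooth1_derivable (k := 0%N) su).
apply: (Ck_on_eq Io _ (Ck_on_mul Io (Ck_on_cst _ _ v) (IHk _ (smooth1_derive su)))).
move=> s Is; have du : differentiable u s by apply/derivable1_diffP;
  exact: (smooth1_derivable (k := 0%N) su).
rewrite (deriveE _ du) derive1E (deriveE _ du) -[RHS]/('d u s v).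
have -> : v = v *: (1 : R) by rewrite /GRing.scale /= mulr1.
by rewrite linearZ /= /GRing.scale /= mulr1.
Qed.

Lemma smooth_on_derive1n W k (I : set R) (x : R -> W) :
  smooth_on I x -> smooth_on I (derive1n k x).
Proof.
move=> sx; elim: k => [//|k IHk]; rewrite derive1nS.
have -> : derive1 (derive1n k x) = (fun s => 'D_1 (derive1n k x) s).
  by apply/funext => t; rewrite derive1E.
exact: smooth_on_derive.
Qed.

Lemma derive1n_coord (m : nat) (I : set R) (x : R -> 'cV[R]_m.+1) k i s :
  open I -> smooth_on I x -> I s ->
  derive1n k x s i 0 = derive1n k (fun s => x s i 0) s.
Proof.
move=> Io sx; elim: k s => [//|k IHk] s Is.
have IHk' t : I t -> derive1n k (fun s => x s i 0) t = derive1n k x t i 0.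
  by move=> It; rewrite IHk.
rewrite !derive1nS (derive1_eq_on Io IHk' Is) !derive1E derive_mx ?mxE //.
by apply/derivable1_diffP; exact: smooth_on_differentiable (smooth_on_derive1n k sx) Is.
Qed.

Lemma smooth_on_coord (m : nat) (I : set R) (x : R -> 'cV[R]_m.+1) i :
  open I -> smooth_on I x -> smooth1 I (fun s => x s i 0).
Proof.
move=> Io sx; split=> k s Is.
have dx : derivable (derive1n k x) s 1.
  by apply/derivable1_diffP; exact: smooth_on_differentiable (smooth_on_derive1n k sx) Is.
have /derivable_mxP /(_ i 0) dxi := dx.
by apply: (derivable_eq_on Io _ Is dxi) => t It; exact: (derive1n_coord k i Io sx It).
Qed.

End CkClosure.

(** * A smooth bump function *)

Section Bump.
Variable R : realType.
Implicit Types (P : {poly R}) (u y : R).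

(** The polynomial parameter closes the family under differentiation, so one computation yields all
    derivatives of exp(-1/u) extended by zero. *)
Definition flat P u : R := if 0 < u then P.[u^-1] * expR (- u^-1) else 0.

Lemma exprn_expRN_bounded k : exists C : R, forall y, 0 < y -> y ^+ k * expR (- y) <= C.
Proof.
exists (k`!%:R) => y y0.
rewrite expRN ler_pdivrMr ?expR_gt0 //.
(* For positive exponents a single term of the exponential series suffices: y^k / k! <= exp(y). *)
case: k => [|k]; first by rewrite expr0 fact0 mul1r -[leLHS]addr0
  (le_trans _ (expR_ge1Dx y)) // lerD2l ltW.
have := expR_ge1Dxn k (ltW y0).
have f0 : 0 < k.+1`!%:R :> R by rewrite ltr0n fact_gt0.
move=> h; rewrite mulrC -ler_pdivrMr //; apply: le_trans h.
by rewrite lerDr.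
Qed.

Lemma poly_expRN_bounded P : exists C : R, forall y, 0 < y -> `|P.[y] * expR (- y)| <= C.
Proof.
(* The free power of [y] absorbs the factor that each Horner step of the induction on [P]
   produces. *)
suff H k : exists C : R, forall y, 0 < y -> `|y ^+ k * P.[y] * expR (- y)| <= C.
  by have [C HC] := H 0%N; exists C => y /HC; rewrite expr0 mul1r.
elim/poly_ind: P k => [|P c IHP] k.
  by exists 0 => y _; rewrite horner0 mulr0 mul0r normr0.
have [C1 H1] := IHP k.+1; have [C2 H2] := exprn_expRN_bounded k.
exists (C1 + `|c| * C2) => y y0.
rewrite hornerD hornerM hornerX hornerC.
have -> : y ^+ k * (P.[y] * y + c) * expR (- y) =
    y ^+ k.+1 * P.[y] * expR (- y) + c * (y ^+ k * expR (- y)) by rewrite exprS; ring.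
apply: (le_trans (ler_normD _ _)); apply: lerD; first exact: H1.
rewrite normrM ler_wpM2l // ger0_norm ?H2 //.
by rewrite mulr_ge0 ?expR_ge0 // exprn_ge0 // ltW.
Qed.

(** Boundedness of y^2 P(y) exp(-y), read at y = 1/u. The exponent 2 makes the difference quotient
    at 0 of order u, hence the derivative there zero. *)
Lemma flat_quadratic P : exists C : R, forall u, `|flat P u| <= C * u ^+ 2.
Proof.
have [C HC] := poly_expRN_bounded ('X^2 * P).
have C0 : 0 <= C by apply: le_trans (HC 1 ltr01).
exists C => u; rewrite /flat; case: ifPn => [u0|_]; last first.
  by rewrite normr0 mulr_ge0 // sqr_ge0.
have := HC u^-1; rewrite invr_gt0 => /(_ u0).
rewrite hornerM hornerXn => H.
have -> : P.[u^-1] * expR (- u^-1) = (u^-1 ^+ 2 * P.[u^-1] * expR (- u^-1)) * u ^+ 2.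
  by field; rewrite gt_eqF.
by rewrite normrM [`|u ^+ 2|]ger0_norm ?sqr_ge0 // ler_wpM2r // sqr_ge0.
Qed.

Lemma is_derive_quadratic (f : R -> R) (C : R) :
  (forall u, `|f u| <= C * u ^+ 2) -> is_derive (0 : R) (1 : R) f 0.
Proof.
move=> fC; have f0 : f 0 = 0.
  by apply/eqP; rewrite -normr_le0 (le_trans (fC 0)) // expr2 mulr0 mulr0.
have H : h^-1 *: (f (h *: (1 : R^o) + 0) - f 0) @[h --> 0^'] --> (0 : R).
  apply: norm_cvg0.
  have bnd : (fun h : R => `|C| * `|h|) @ 0^' --> (0 : R).
    rewrite -[X in _ --> X](mulr0 `|C|); apply: (cvgMl_tmp (F := 0^')).
    rewrite -[X in _ --> X](normr0 R).
    by apply: cvg_within_filter; exact: (@norm_continuous _ R 0).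
  apply: (squeeze_cvgr _ (cvg_cst 0) bnd).
  near=> h; rewrite normr_ge0 /= f0 subr0 addr0 [h *: _]mulr1 normrZ.
  have h0 : h != 0 by near: h; exact: nbhs_dnbhs_neq.
  rewrite normfV mulrC ler_pdivrMr ?normr_gt0 //.
  apply: (le_trans (fC h)); rewrite -mulrA -expr2 -normrX [`|h ^+ 2|]ger0_norm ?sqr_ge0 //.
  by rewrite ler_wpM2r ?sqr_ge0 // ler_norm.
apply: DeriveDef; first exact: (cvgP _ H).
exact: (cvg_lim _ H).
Unshelve. all: by end_near. Qed.

(** With y = 1/u one has d/du = - y^2 d/dy, and d/dy sends P(y) exp(-y) to (P' - P)(y) exp(-y). *)
Definition flatD P : {poly R} := 'X^2 * (P - P^`()).

Lemma is_derive_flat P u : is_derive u 1 (flat P) (flat (flatD P) u).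
Proof.
have [u0|u0|->] := ltgtP u 0; last first.
- have [C HC] := flat_quadratic P.
  by rewrite {2}/flat ltxx; exact: is_derive_quadratic HC.
- rewrite {2}/flat u0.
  have dV : is_derive u 1 (fun t : R => t^-1) (- 1 * u^-1 * u^-1).
    by apply: is_derive_inv; rewrite gt_eqF.
  have dP := is_derive1_comp (is_derive_poly P u^-1) dV.
  have dN : is_derive u 1 (fun t : R => - t^-1) (- (- 1 * u^-1 * u^-1)).
    exact: (is_deriveN dV).
  have dE := is_derive1_comp (f := expR) (g := fun t => - t^-1)
    (is_derive_expR (- u^-1)) dN.
  have H := is_derive_mul dP dE.
  apply: (@near_eq_is_derive R R^o R^o (fun t : R => P.[t^-1] * expR (- t^-1))).
    by near=> t; rewrite /flat ifT //; near: t; exact: lt_nbhsr.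
  apply: (is_derive_eq H).
  by rewrite /flatD hornerM hornerXn hornerD hornerN /=; ring.
- rewrite {2}/flat ltNge (ltW u0) /=.
  apply: (@near_eq_is_derive R R^o R^o (fun _ : R => 0)).
  by near=> t; rewrite /flat ltNge ltW //; near: t; exact: lt_nbhsl.
Unshelve. all: by end_near. Qed.

(** An affine argument covers both factors of [bump]. The factor [c] of the chain rule is absorbed
    into the polynomial, in which [flat] is linear. *)
Lemma smooth1_flat P (c d : R) : smooth1 setT (fun s => flat P (c * s + d)).
Proof.
have dl (s : R) : is_derive s (1 : R) (fun t : R => c * t + d) c.
  have := is_derive_add (is_derive_mul (is_derive_cst c s (1 : R^o))
    (is_derive_id s (1 : R^o))) (is_derive_cst d s (1 : R^o)).
  by rewrite /= mulr0 !addr0 mulr1.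
have dH (Q : {poly R}) (s : R) :
    is_derive s 1 (fun s => flat Q (c * s + d)) (flat (flatD Q) (c * s + d) * c).
  exact: (is_derive1_comp (f := flat Q) (g := fun t => c * t + d) (is_derive_flat Q _) (dl s)).
have flatZ (a : R) Q s : flat (a *: Q) s = flat Q s * a.
  by rewrite /flat; case: ifP => _; rewrite ?mul0r // hornerZ; ring.
have nH k : exists Q, derive1n k (fun s => flat P (c * s + d)) = fun s => flat Q (c * s + d).
  elim: k => [|k [Q HQ]]; first by exists P.
  exists (c *: flatD Q); rewrite derive1nS HQ; apply/funext => s.
  by rewrite (is_derive1E (dH Q s)) flatZ.
by split=> k s _; have [Q ->] := nH k; exact: (dH Q s).(ex_derive).
Qed.

Definition bump (a b s : R) : R := flat 1 (s - a) * flat 1 (b - s).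

Lemma smooth1_bump a b : smooth1 setT (bump a b).
Proof.
have oT : open [set: R] by exact: openT.
have H := smooth1_mul oT (smooth1_flat 1 1 (- a)) (smooth1_flat 1 (-1) b).
apply: (smooth1_eq oT _ H).
by move=> s _; rewrite /bump mul1r mulN1r [- s + b]addrC.
Qed.

Lemma flat1_gt0 u : 0 < u -> 0 < flat 1 u.
Proof. by move=> u0; rewrite /flat u0 hornerC mul1r expR_gt0. Qed.

Lemma flat_le0 P u : u <= 0 -> flat P u = 0.
Proof. by move=> u0; rewrite /flat ltNge u0. Qed.

Lemma bump_gt0 a b s : a < s -> s < b -> 0 < bump a b s.
Proof. by move=> sa sb; rewrite mulr_gt0 // flat1_gt0 // subr_gt0. Qed.

Lemma bump_eq0 a b s : ~ (a <= s <= b) -> bump a b s = 0.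
Proof.
move=> /negP; rewrite negb_and -!ltNge => /orP[sa|bs]; rewrite /bump.
  by rewrite flat_le0 ?mul0r // subr_le0 ltW.
by rewrite [flat 1 (b - s)]flat_le0 ?mulr0 // subr_le0 ltW.
Qed.

Lemma bump_ge0 a b s : 0 <= bump a b s.
Proof.
have H u : 0 <= flat 1 u by have [/flat1_gt0/ltW|/flat_le0->] := ltP 0 u.
exact: mulr_ge0.
Qed.

End Bump.

(** * Curves x + e phi c *)

Section Coordinates.
Variable R : realType.
Implicit Types u v : 'cV[R]_3.

(** Vectors become coordinate functions, so that vector identities unfold to polynomial identities
    in reach of [ring]. *)
Definition dot3 (a b : 'I_3 -> R) : R := a 0 * b 0 + a 1 * b 1 + a 2 * b 2.

Definition cross3 (a b : 'I_3 -> R) (i : 'I_3) : R :=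
  [:: a 1 * b 2 - a 2 * b 1; a 2 * b 0 - a 0 * b 2; a 0 * b 1 - a 1 * b 0]`_i.

Lemma sum_ord3 (f : 'I_3 -> R) : \sum_i f i = f 0 + f 1 + f 2.
Proof.
rewrite !big_ord_recl big_ord0 addr0 addrA.
by congr (_ + f _ + f _); exact: val_inj.
Qed.

Lemma ord3P (P : 'I_3 -> Prop) : P 0 -> P 1 -> P 2 -> forall i, P i.
Proof.
move=> P0 P1 P2 [[|[|[|//]]] H].
- by rewrite (_ : Ordinal H = 0) //; exact: val_inj.
- by rewrite (_ : Ordinal H = 1) //; exact: val_inj.
- by rewrite (_ : Ordinal H = 2) //; exact: val_inj.
Qed.

Lemma dotpE u v : dotp u v = dot3 (fun i => u i 0) (fun i => v i 0).
Proof. by rewrite /dotp mxE sum_ord3 !mxE. Qed.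

Lemma crosspE u v i : crossp u v i 0 = cross3 (fun i => u i 0) (fun i => v i 0) i.
Proof. by rewrite mxE. Qed.

Lemma eq_dot3 (a a' b b' : 'I_3 -> R) : a =1 a' -> b =1 b' -> dot3 a b = dot3 a' b'.
Proof. by move=> ea eb; rewrite /dot3 !ea !eb. Qed.

Lemma eq_cross3 (a a' b b' : 'I_3 -> R) : a =1 a' -> b =1 b' -> cross3 a b =1 cross3 a' b'.
Proof. by move=> ea eb i; rewrite /cross3 !ea !eb. Qed.

Lemma cross30 (a b : 'I_3 -> R) : cross3 a b 0 = a 1 * b 2 - a 2 * b 1.
Proof. by []. Qed.

Lemma cross31 (a b : 'I_3 -> R) : cross3 a b 1 = a 2 * b 0 - a 0 * b 2.
Proof. by []. Qed.

Lemma cross32 (a b : 'I_3 -> R) : cross3 a b 2 = a 0 * b 1 - a 1 * b 0.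
Proof. by []. Qed.

Definition cross3E := (cross30, cross31, cross32).

End Coordinates.

Section Variation.
Variables (R : realType) (n : nat) (I : set R).
Hypothesis I_open : open I.
Variables (x : R -> 'cV[R]_3) (phi : R -> R) (c : 'cV[R]_3).
Hypothesis x_smooth : smooth_on I x.
Hypothesis phi_smooth : smooth1 I phi.

Definition vary (p : R * R) : 'cV[R]_3 := x p.2 + (p.1 * phi p.2) *: c.

Lemma vary0 : (fun s => vary (0, s)) = x.
Proof. by apply/funext => s; rewrite /vary /= mul0r scale0r addr0. Qed.

(** This is the smoothness that [curve_variation] demands, for every width [d]: the family is affine
    in [e], with coefficients smooth in [s]. *)
Lemma smooth_on_vary (d : R) : smooth_on [set p : R * R | `|p.1| < d /\ I p.2] vary.
Proof.
set U := [set p | _].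
have Uo : open U.
  apply: (@openI _ [set p : R * R | `|p.1| < d] (cylinder I)); last exact: open_cylinder.
  apply: (@open_comp _ _ (fun p : R * R => `|p.1|) [set t | t < d]); last exact: open_lt.
  by move=> p _; apply: continuous_comp; [exact: cvg_fst|exact: norm_continuous].
have UI p : U p -> I p.2 by case.
move=> k; apply: Ck_on_add => //; first exact: Ck_on_snd UI (x_smooth k).
apply: Ck_on_scalel => //; apply: Ck_on_mul => //; first exact: Ck_on_fst.
exact: Ck_on_snd UI (smooth1_smooth_on I_open phi_smooth k).
Qed.

Lemma smooth_on_vary_slice e : smooth_on I (fun s => vary (e, s)).
Proof.
move=> k; apply: Ck_on_add => //; apply: Ck_on_scalel => //; apply: Ck_on_mul => //.
  exact: Ck_on_cst.
exact: (smooth1_smooth_on I_open phi_smooth k).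
Qed.

Definition xD k i (s : R) := derive1n k (fun t => x t i 0) s.

(** Closed form of the k-th [s]-derivative of the varied curve. Visibly in the class [smooth2], it
    brings speed, curvature and torsion of the varied curves into that class. *)
Definition varyD k i (p : R * R) : R := xD k i p.2 + p.1 * derive1n k phi p.2 * c i 0.

Lemma smooth1_xD k i : smooth1 I (xD k i).
Proof. by apply: smooth1_derive1n; exact: smooth_on_coord. Qed.

Lemma derive1n_vary e k s i : I s -> derive1n k (fun s => vary (e, s)) s i 0 = varyD k i (e, s).
Proof.
move=> Is; rewrite (derive1n_coord k i I_open (smooth_on_vary_slice e) Is).
elim: k s Is => [|k IHk] s Is; first by rewrite /= !mxE.
rewrite derive1nS (derive1_eq_on I_open IHk Is) /varyD /xD /=.
have dx := smooth1_is_derive (smooth1_xD k i) Is.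
have dp := smooth1_is_derive (smooth1_derive1n k phi_smooth) Is.
have dz := is_derive_add dx (is_derive_mul (is_derive_mul
  (is_derive_cst e s (1 : R^o)) dp) (is_derive_cst (c i 0) s (1 : R^o))).
rewrite (is_derive1E dz) /= ?mulr0 ?add0r ?addr0.
by congr (_ + _); rewrite mulrC.
Qed.

Lemma derive1_vary e s i : I s -> derive1 (fun s => vary (e, s)) s i 0 = varyD 1 i (e, s).
Proof. exact: (derive1n_vary e 1). Qed.

Variable b : bool.

Lemma smooth2_varyD k i : @smooth2 R n b (cylinder I) (varyD k i).
Proof.
apply: smooth2_add; first by apply: smooth2_base I_open (smooth1_xD k i) _.
apply: smooth2_mul; last exact: smooth2_cst.
apply: smooth2_mul; first exact: smooth2_fst.
by apply: smooth2_base I_open (smooth1_derive1n k phi_smooth) _.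
Qed.

Definition vary_sqspeed (p : R * R) : R :=
  dot3 (fun i => varyD 1 i p) (fun i => varyD 1 i p).
Definition vary_cross (p : R * R) : 'I_3 -> R :=
  cross3 (fun i => varyD 1 i p) (fun i => varyD 2 i p).
Definition vary_sqcross (p : R * R) : R := dot3 (vary_cross p) (vary_cross p).
Definition vary_triple (p : R * R) : R := dot3 (fun i => varyD 3 i p) (vary_cross p).

Lemma smooth2_dot3 W (f g : 'I_3 -> R * R -> R) :
  (forall i, @smooth2 R n b W (f i)) -> (forall i, @smooth2 R n b W (g i)) ->
  @smooth2 R n b W (fun p => dot3 (f^~ p) (g^~ p)).
Proof. by move=> sf sg; do 2?[apply: smooth2_add]; apply: smooth2_mul. Qed.

Lemma smooth2_cross3 W (f g : 'I_3 -> R * R -> R) i :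
  (forall i, @smooth2 R n b W (f i)) -> (forall i, @smooth2 R n b W (g i)) ->
  @smooth2 R n b W (fun p => cross3 (f^~ p) (g^~ p) i).
Proof.
move=> sf sg; elim/ord3P: i; apply: smooth2_add; do ?apply: smooth2_opp;
  exact: smooth2_mul.
Qed.

Lemma smooth2_vary_sqspeed : @smooth2 R n b (cylinder I) vary_sqspeed.
Proof. by apply: smooth2_dot3 => i; exact: smooth2_varyD. Qed.

Lemma smooth2_vary_cross i : @smooth2 R n b (cylinder I) (fun p => vary_cross p i).
Proof. by apply: smooth2_cross3 => j; exact: smooth2_varyD. Qed.

Lemma smooth2_vary_sqcross : @smooth2 R n b (cylinder I) vary_sqcross.
Proof.
by apply: (smooth2_dot3 (f := fun i p => vary_cross p i) (g := fun i p => vary_cross p i)) => i;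
  exact: smooth2_vary_cross.
Qed.

Lemma smooth2_vary_triple : @smooth2 R n b (cylinder I) vary_triple.
Proof.
by apply: (smooth2_dot3 (g := fun i p => vary_cross p i)) => i;
  [exact: smooth2_varyD|exact: smooth2_vary_cross].
Qed.

Lemma speed_vary e s : I s -> speed (fun s => vary (e, s)) s = Num.sqrt (vary_sqspeed (e, s)).
Proof.
move=> Is; rewrite /speed /enorm dotpE; congr Num.sqrt.
by apply: eq_dot3 => i; rewrite derive1_vary.
Qed.

Lemma crossp_vary e s i : I s ->
  crossp (derive1 (fun s => vary (e, s)) s) (derive1n 2 (fun s => vary (e, s)) s) i 0 =
  vary_cross (e, s) i.
Proof.
move=> Is; rewrite crosspE; apply: eq_cross3 => j.
  by rewrite derive1_vary.
by rewrite derive1n_vary.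
Qed.

Lemma curvature_vary e s : I s -> curvature (fun s => vary (e, s)) s =
  Num.sqrt (vary_sqcross (e, s)) / Num.sqrt (vary_sqspeed (e, s)) ^+ 3.
Proof.
move=> Is; rewrite /curvature; congr (_ / _ ^+ _); last exact: speed_vary.
rewrite /enorm dotpE; congr Num.sqrt.
by apply: eq_dot3 => i; rewrite crossp_vary.
Qed.

Lemma torsion_vary e s : I s -> torsion (fun s => vary (e, s)) s =
  vary_triple (e, s) / Num.sqrt (vary_sqcross (e, s)) ^+ 2.
Proof.
move=> Is; rewrite /torsion; congr (_ / _ ^+ _).
  by rewrite dotpE; apply: eq_dot3 => i; rewrite ?derive1n_vary ?crossp_vary.
rewrite /enorm dotpE; congr Num.sqrt.
by apply: eq_dot3 => i; rewrite crossp_vary.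
Qed.

(** Here the inverses and square roots in curvature and torsion are legitimate. The set is open and
    contains the line e = 0 over [I], which is what derivatives at e = 0 require. *)
Definition regular : set (R * R) :=
  [set p | [/\ I p.2, 0 < vary_sqspeed p & 0 < vary_sqcross p]].

End Variation.

Section RealVectorDerivatives.
Variable R : realType.
Implicit Types (f g : 'I_3 -> R -> R) (df dg : 'I_3 -> R) (t : R).

Lemma is_derive_sub (f g : R -> R) t a b :
  is_derive t 1 f a -> is_derive t 1 g b -> is_derive t 1 (fun t => f t - g t) (a - b).
Proof. by move=> df dg; exact: is_deriveB. Qed.

Lemma is_derive_dot3 f g df dg t :
  (forall i, is_derive t 1 (f i) (df i)) -> (forall i, is_derive t 1 (g i) (dg i)) ->
  is_derive t 1 (fun t => dot3 (f^~ t) (g^~ t)) (dot3 df (g^~ t) + dot3 (f^~ t) dg).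
Proof.
move=> hf hg; rewrite /dot3.
apply: (is_derive_eq (is_derive_add (is_derive_add (is_derive_mul (hf 0) (hg 0))
  (is_derive_mul (hf 1) (hg 1))) (is_derive_mul (hf 2) (hg 2)))).
by ring.
Qed.

Lemma is_derive_cross3 f g df dg t i :
  (forall i, is_derive t 1 (f i) (df i)) -> (forall i, is_derive t 1 (g i) (dg i)) ->
  is_derive t 1 (fun t => cross3 (f^~ t) (g^~ t) i)
    (cross3 df (g^~ t) i + cross3 (f^~ t) dg i).
Proof.
move=> hf hg; elim/ord3P: i; rewrite !cross3E.
- apply: (is_derive_eq (is_derive_sub (is_derive_mul (hf 1) (hg 2))
    (is_derive_mul (hf 2) (hg 1)))); by ring.
- apply: (is_derive_eq (is_derive_sub (is_derive_mul (hf 2) (hg 0))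
    (is_derive_mul (hf 0) (hg 2)))); by ring.
- apply: (is_derive_eq (is_derive_sub (is_derive_mul (hf 0) (hg 1))
    (is_derive_mul (hf 1) (hg 0)))); by ring.
Qed.

Lemma dot3C (a b : 'I_3 -> R) : dot3 a b = dot3 b a.
Proof. by rewrite /dot3; ring. Qed.

Lemma dot3_ge0 (a : 'I_3 -> R) : 0 <= dot3 a a.
Proof. by rewrite /dot3 !addr_ge0 // -expr2 sqr_ge0. Qed.

End RealVectorDerivatives.

(** * Curvature, torsion and their arc length derivatives along the varied curves *)

Section JetVariation.
Variables (R : realType) (n : nat) (I : set R).
Hypothesis I_open : open I.
Variables (x : R -> 'cV[R]_3) (phi : R -> R) (c : 'cV[R]_3).
Hypothesis x_smooth : smooth_on I x.
Hypothesis phi_smooth : smooth1 I phi.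

Local Notation vary := (vary x phi c).
Local Notation varyD := (varyD x phi c).
Local Notation regular := (regular I x phi c).
Local Notation sqspeed := (vary_sqspeed x phi c).
Local Notation sqcross := (vary_sqcross x phi c).

Lemma smooth2_subset b (W W' : set (R * R)) f :
  W' `<=` W -> @smooth2 R n b W f -> @smooth2 R n b W' f.
Proof.
move=> WW'; elim => {f}.
- by move=> J u Jo su WJ; apply: smooth2_base Jo su _ => p /WW'; exact: WJ.
- exact: smooth2_fst.
- by move=> f g _ sf _ sg; exact: smooth2_add.
- by move=> f g _ sf _ sg; exact: smooth2_mul.
- by move=> f _ sf f0; apply: smooth2_inv => // p /WW'; exact: f0.
- by move=> f _ sf f0; apply: smooth2_sqrt => // p /WW'; exact: f0.
- move=> U G f g bT sG _ sf _ sg WU.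
  by apply: (smooth2_comp bT sG sf sg) => p /WW'; exact: WU.
- by move=> f g _ sf fg; apply: (smooth2_eq sf) => p /WW'; exact: fg.
Qed.

Lemma open_regular : open regular.
Proof.
rewrite openE => p [Ip v0 c0].
have co := open_cylinder I_open.
have cv := smooth2_continuous co
  (smooth2_vary_sqspeed 0 I_open c x_smooth phi_smooth false) Ip.
have cc := smooth2_continuous co
  (smooth2_vary_sqcross 0 I_open c x_smooth phi_smooth false) Ip.
have nv : \forall q \near p, 0 < sqspeed q by exact: (cvgr_gt _ cv).
have nc : \forall q \near p, 0 < sqcross q by exact: (cvgr_gt _ cc).
have nI : \forall q \near p, cylinder I q by apply: open_nbhs_nbhs; split.
rewrite /interior; near=> q; split.
- by near: q; exact: nI.
- by near: q; exact: nv.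
- by near: q; exact: nc.
Unshelve. all: by end_near. Qed.

Lemma regular_cylinder : regular `<=` cylinder I.
Proof. by move=> p []. Qed.

Definition kappav m (p : R * R) := kappa_ (fun s => vary (p.1, s)) m p.2.
Definition tauv m (p : R * R) := tau_ (fun s => vary (p.1, s)) m p.2.

Definition vspeed (p : R * R) := Num.sqrt (sqspeed p).

Lemma smooth2_vspeed b : @smooth2 R n b regular vspeed.
Proof.
apply: smooth2_sqrt => [|p []//].
by apply: (smooth2_subset regular_cylinder); exact: smooth2_vary_sqspeed.
Qed.

Lemma vspeed_neq0 p : regular p -> vspeed p != 0.
Proof. by move=> [_ v0 _]; rewrite gt_eqF // sqrtr_gt0. Qed.

Lemma smooth2_sqrt_sqcross b : @smooth2 R n b regular (fun p => Num.sqrt (sqcross p)).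
Proof.
apply: smooth2_sqrt => [|p []//].
by apply: (smooth2_subset regular_cylinder); exact: smooth2_vary_sqcross.
Qed.

Lemma kappav0 p : regular p -> kappav 0 p = Num.sqrt (sqcross p) / vspeed p ^+ 3.
Proof.
case: p => e s [Is _ _].
by rewrite /kappav /= (curvature_vary I_open c x_smooth phi_smooth e Is).
Qed.

Lemma tauv0 p : regular p -> tauv 0 p = vary_triple x phi c p / Num.sqrt (sqcross p) ^+ 2.
Proof.
case: p => e s [Is _ _].
by rewrite /tauv /= (torsion_vary I_open c x_smooth phi_smooth e Is).
Qed.

Lemma kappavS m p : regular p -> kappav m.+1 p = partial_s (kappav m) p / vspeed p.
Proof.
by case: p => e s [Is _ _]; rewrite /kappav /= /arcD (speed_vary I_open c x_smooth phi_smooth e Is).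
Qed.

Lemma tauvS m p : regular p -> tauv m.+1 p = partial_s (tauv m) p / vspeed p.
Proof.
by case: p => e s [Is _ _]; rewrite /tauv /= /arcD (speed_vary I_open c x_smooth phi_smooth e Is).
Qed.

Lemma smooth2_exp b W f k : @smooth2 R n b W f -> @smooth2 R n b W (fun p => f p ^+ k).
Proof.
move=> sf; elim: k => [|k IHk]; first by apply: smooth2_eq (smooth2_cst _ _ _ 1) _.
by apply: smooth2_eq (smooth2_mul sf IHk) _ => p _; rewrite exprS.
Qed.

Lemma smooth2_arcD b (f g : R * R -> R) : @smooth2 R n b regular f ->
  (forall p, regular p -> g p = partial_s f p / vspeed p) -> @smooth2 R n b regular g.
Proof.
move=> sf fg; apply: (@smooth2_eq _ _ _ _ (fun p => partial_s f p * (vspeed p)^-1)).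
  apply: smooth2_mul; first exact: smooth2_partial_s open_regular _ sf.
  by apply: smooth2_inv => [|p]; [exact: smooth2_vspeed|exact: vspeed_neq0].
by move=> p rp; rewrite fg.
Qed.

Lemma smooth2_kappav b m : @smooth2 R n b regular (kappav m).
Proof.
elim: m => [|m IHm]; last by apply: (smooth2_arcD IHm) => p; exact: kappavS.
apply: (@smooth2_eq _ _ _ _ (fun p => Num.sqrt (sqcross p) * (vspeed p ^+ 3)^-1)).
  apply: smooth2_mul; first exact: smooth2_sqrt_sqcross.
  apply: smooth2_inv; first by apply: smooth2_exp; exact: smooth2_vspeed.
  by move=> p rp; rewrite expf_neq0 // vspeed_neq0.
by move=> p rp; rewrite kappav0.
Qed.

Lemma smooth2_tauv b m : @smooth2 R n b regular (tauv m).
Proof.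
elim: m => [|m IHm]; last by apply: (smooth2_arcD IHm) => p; exact: tauvS.
apply: (@smooth2_eq _ _ _ _ (fun p => vary_triple x phi c p * (Num.sqrt (sqcross p) ^+ 2)^-1)).
  apply: smooth2_mul.
    by apply: (smooth2_subset regular_cylinder); exact: smooth2_vary_triple.
  apply: smooth2_inv; first by apply: smooth2_exp; exact: smooth2_sqrt_sqcross.
  by move=> p [_ _ c0]; rewrite expf_neq0 // gt_eqF // sqrtr_gt0.
by move=> p rp; rewrite tauv0.
Qed.

Hypothesis x_arclength : forall s, I s -> enorm (derive1 x s) = 1.
Hypothesis x_curved : forall s, I s -> curvature x s != 0.

Lemma sqspeed0 s : I s -> sqspeed (0, s) = 1.
Proof.
move=> Is; have := speed_vary I_open c x_smooth phi_smooth 0 Is.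
rewrite vary0 /speed x_arclength // => /(congr1 (fun r => r ^+ 2)).
by rewrite sqr_sqrtr ?dot3_ge0 // expr1n.
Qed.

Lemma vspeed0 s : I s -> vspeed (0, s) = 1.
Proof. by move=> Is; rewrite /vspeed sqspeed0 // sqrtr1. Qed.

Lemma sqrt_sqcross0 s : I s -> Num.sqrt (sqcross (0, s)) = curvature x s.
Proof.
move=> Is; have := curvature_vary I_open c x_smooth phi_smooth 0 Is.
by rewrite vary0 sqspeed0 // sqrtr1 expr1n divr1.
Qed.

Lemma sqcross0_gt0 s : I s -> 0 < sqcross (0, s).
Proof.
move=> Is; rewrite lt_neqAle dot3_ge0 andbT eq_sym; apply/eqP => c0.
have := x_curved Is; rewrite -(sqrt_sqcross0 Is) c0 sqrtr0.
by rewrite eqxx.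
Qed.

Lemma regular0 s : I s -> regular (0, s).
Proof. by move=> Is; split => //; [rewrite sqspeed0|exact: sqcross0_gt0]. Qed.

Lemma kappav_at0 m s : kappav m (0, s) = kappa_ x m s.
Proof. by rewrite /kappav /= vary0. Qed.

Lemma tauv_at0 m s : tauv m (0, s) = tau_ x m s.
Proof. by rewrite /tauv /= vary0. Qed.

(** The k-th derivative of the variation field phi c, equal to d/de of [varyD k i]. *)
Definition eta k i (s : R) := derive1n k phi s * c i 0.

Lemma is_derive_varyD k i (e s : R) : is_derive e (1 : R) (fun e => varyD k i (e, s)) (eta k i s).
Proof.
rewrite /varyD /eta /=.
have := is_derive_add (is_derive_cst (xD x k i s) e (1 : R^o)) (is_derive_mul (is_derive_mul
  (is_derive_id e (1 : R^o)) (is_derive_cst (derive1n k phi s) e (1 : R^o)))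
  (is_derive_cst (c i 0) e (1 : R^o))).
by move=> H; apply: (is_derive_eq H); rewrite /=; ring.
Qed.

(** The rate of change at e = 0 of the arc length element, x_s . (phi c)_s. *)
Definition stretch (s : R) : R := dot3 (fun i => xD x 1 i s) (fun i => eta 1 i s).

Lemma varyD0 k i s : varyD k i (0, s) = xD x k i s.
Proof. by rewrite /varyD /= !mul0r addr0. Qed.

Lemma is_derive_vspeed s : I s -> is_derive (0 : R) (1 : R) (fun e => vspeed (e, s)) (stretch s).
Proof.
move=> Is.
have dv := is_derive_dot3 (fun i => is_derive_varyD 1 i 0 s) (fun i => is_derive_varyD 1 i 0 s).
have v0 : 0 < sqspeed (0, s) by rewrite sqspeed0.
apply: (is_derive_eq (is_derive_sqrt (f := fun e => sqspeed (e, s)) v0 dv)).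
rewrite -[Num.sqrt _]/(vspeed (0, s)) vspeed0 //.
rewrite /stretch invr1 mulr1 [dot3 _ (fun i => eta 1 i s)]dot3C.
by rewrite /dot3 !varyD0; field.
Qed.

Lemma partial_e_eq (f g : R * R -> R) (e s d : R) : regular (e, s) ->
  (forall p, regular p -> g p = f p) -> is_derive e (1 : R) (fun e => f (e, s)) d ->
  partial_e g (e, s) = d.
Proof.
move=> rs fg df; apply: is_derive1E; apply: near_eq_is_derive df.
by apply: (near_slice_e open_regular (P := fun p => f p = g p) rs) => q /fg.
Qed.

(** The commutator of d/de with D_s = (1/speed) d/ds. Mixed partials commute, which is where the
    flag [false] is needed, and 1/speed has [e]-derivative [- stretch] at e = 0, where the speed is
    1. *)
Lemma partial_e_arcD (f g : R * R -> R) s : @smooth2 R n false regular f ->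
  (forall p, regular p -> g p = partial_s f p / vspeed p) -> I s ->
  partial_e g (0, s) = derive1 (fun t => partial_e f (0, t)) s - stretch s * g (0, s).
Proof.
move=> sf fg Is; have rs := regular0 Is; have ro := open_regular.
have dps := smooth2_is_derive_e ro (smooth2_partial_s ro sf) rs.
have v1 := vspeed0 Is.
have dV : is_derive (0 : R) (1 : R) (fun e => (vspeed (e, s))^-1) (- stretch s).
  apply: (is_derive_eq (is_derive_inv (f := fun e => vspeed (e, s))
    (vspeed_neq0 rs) (is_derive_vspeed Is))).
  by rewrite v1 invr1 !mulr1.
rewrite (partial_e_eq (f := fun p => partial_s f p * (vspeed p)^-1) rs fg
  (is_derive_mul dps dV)) (fg _ rs) v1 invr1 mulr1 mul1r.
rewrite (smooth2_mixed ro _ sf rs) // [partial_s (partial_e f) _]/partial_s /=.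
by ring.
Qed.

Lemma partial_e_kappavS m s : I s -> partial_e (kappav m.+1) (0, s) =
  derive1 (fun t => partial_e (kappav m) (0, t)) s - stretch s * kappa_ x m.+1 s.
Proof.
move=> Is; rewrite -(kappav_at0 m.+1 s).
by apply: (partial_e_arcD (smooth2_kappav false m) _ Is) => p; exact: kappavS.
Qed.

Lemma partial_e_tauvS m s : I s -> partial_e (tauv m.+1) (0, s) =
  derive1 (fun t => partial_e (tauv m) (0, t)) s - stretch s * tau_ x m.+1 s.
Proof.
move=> Is; rewrite -(tauv_at0 m.+1 s).
by apply: (partial_e_arcD (smooth2_tauv false m) _ Is) => p; exact: tauvS.
Qed.

Definition xcross (s : R) : 'I_3 -> R := cross3 (fun i => xD x 1 i s) (fun i => xD x 2 i s).

Definition dcross (s : R) (i : 'I_3) : R :=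
  cross3 (fun i => eta 1 i s) (fun i => xD x 2 i s) i +
  cross3 (fun i => xD x 1 i s) (fun i => eta 2 i s) i.

Lemma vary_cross0 s i : vary_cross x phi c (0, s) i = xcross s i.
Proof. by apply: eq_cross3 => j; rewrite varyD0. Qed.

Lemma is_derive_vary_cross s i :
  is_derive (0 : R) (1 : R) (fun e => vary_cross x phi c (e, s) i) (dcross s i).
Proof.
have := is_derive_cross3 i (fun i => is_derive_varyD 1 i 0 s) (fun i => is_derive_varyD 2 i 0 s).
move=> H; apply: (is_derive_eq H).
by congr (_ + _); apply: eq_cross3 => j //; rewrite varyD0.
Qed.

Lemma is_derive_sqrt_sqcross s : I s ->
  is_derive (0 : R) (1 : R) (fun e => Num.sqrt (sqcross (e, s)))
    (dot3 (xcross s) (dcross s) / curvature x s).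
Proof.
move=> Is.
have dv := is_derive_dot3 (is_derive_vary_cross s) (is_derive_vary_cross s).
have v0 := sqcross0_gt0 Is.
apply: (is_derive_eq (is_derive_sqrt (f := fun e => sqcross (e, s)) v0 dv)).
rewrite (sqrt_sqcross0 Is); congr (_ / _).
have E : dot3 (vary_cross x phi c (0, s)) (dcross s) = dot3 (xcross s) (dcross s).
  by apply: eq_dot3 => // i; exact: vary_cross0.
rewrite [X in X + _]dot3C [X in X + _]E [X in _ + X]E.
by move: (dot3 _ _) => r; field.
Qed.

Lemma is_derive_exp (f : R -> R) (t a : R) k : is_derive t 1 f a ->
  is_derive t 1 (fun t => f t ^+ k.+1) (k.+1%:R * f t ^+ k * a).
Proof.
move=> df; elim: k => [|k IHk]; first by rewrite expr0 !mul1r.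
have := is_derive_mul df IHk.
rewrite (_ : (fun t => f t * f t ^+ k.+1) = (fun t => f t ^+ k.+2)); last first.
  by apply/funext => u; rewrite [RHS]exprS.
move=> H; apply: (is_derive_eq H).
by rewrite -[k.+2]addn1 natrD !exprS; ring.
Qed.

Lemma partial_e_kappav0 s : I s -> partial_e (kappav 0) (0, s) =
  dot3 (xcross s) (dcross s) / curvature x s - 3 * curvature x s * stretch s.
Proof.
move=> Is; have rs := regular0 Is; have ro := open_regular.
have v1 := vspeed0 Is.
have dV3 := is_derive_exp 2 (is_derive_vspeed Is).
have dV : is_derive (0 : R) (1 : R) (fun e => (vspeed (e, s) ^+ 3)^-1) (- (3 * stretch s)).
  have v30 : vspeed (0, s) ^+ 3 != 0 by rewrite expf_neq0 // vspeed_neq0.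
  apply: (is_derive_eq (is_derive_inv (f := fun e => vspeed (e, s) ^+ 3) v30 dV3)).
  by rewrite v1 !expr1n invr1 !mulr1.
rewrite (partial_e_eq (f := fun p => Num.sqrt (sqcross p) * (vspeed p ^+ 3)^-1) rs kappav0
  (is_derive_mul (is_derive_sqrt_sqcross Is) dV)).
rewrite sqrt_sqcross0 // v1 expr1n invr1.
by ring.
Qed.

Lemma partial_e_tauv0 s : I s -> partial_e (tauv 0) (0, s) =
  (dot3 (fun i => eta 3 i s) (xcross s) + dot3 (fun i => xD x 3 i s) (dcross s))
    / curvature x s ^+ 2
  - 2 * torsion x s * (dot3 (xcross s) (dcross s) / curvature x s) / curvature x s.
Proof.
move=> Is; have rs := regular0 Is; have ro := open_regular.
have k0 := x_curved Is; have sk := sqrt_sqcross0 Is.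
have dT := is_derive_dot3 (fun i => is_derive_varyD 3 i 0 s) (is_derive_vary_cross s).
have dV2 := is_derive_exp 1 (is_derive_sqrt_sqcross Is).
have v20 : Num.sqrt (sqcross (0, s)) ^+ 2 != 0 by rewrite sk expf_neq0.
have dV := is_derive_inv (f := fun e => Num.sqrt (sqcross (e, s)) ^+ 2) v20 dV2.
have t0 : torsion x s = vary_triple x phi c (0, s) / curvature x s ^+ 2.
  by rewrite -[LHS](tauv_at0 0) tauv0 // sk.
rewrite (partial_e_eq (f := fun p => vary_triple x phi c p * (Num.sqrt (sqcross p) ^+ 2)^-1)
  rs tauv0 (is_derive_mul dT dV)) sk t0
  -[dot3 (fun i => varyD 3 i (0, s)) _]/(vary_triple x phi c (0, s)).
have -> : dot3 (fun i => eta 3 i s) (vary_cross x phi c (0, s)) =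
    dot3 (fun i => eta 3 i s) (xcross s).
  by apply: eq_dot3 => // i; rewrite vary_cross0.
have -> : dot3 (fun i => varyD 3 i (0, s)) (dcross s) = dot3 (fun i => xD x 3 i s) (dcross s).
  by apply: eq_dot3 => // i; rewrite varyD0.
by field.
Qed.

End JetVariation.

(** * Frenet equations *)

Section Frenet.
Variables (R : realType) (I : set R) (x : R -> 'cV[R]_3).
Hypothesis I_open : open I.
Hypothesis x_smooth : smooth_on I x.
Hypothesis x_arclength : forall s, I s -> enorm (derive1 x s) = 1.
Hypothesis x_curved : forall s, I s -> curvature x s != 0.

Local Notation K := (curvature x).
Local Notation T := (torsion x).
Local Notation xv k s := (fun i => xD x k i s).
Local Notation A := (xcross x).

Lemma is_derive_xD k i s : I s -> is_derive s (1 : R) (xD x k i) (xD x k.+1 i s).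
Proof. by move=> Is; exact: (smooth1_is_derive (smooth1_xD I_open x_smooth k i) Is). Qed.

Lemma is_derive_xcross i s : I s ->
  is_derive s (1 : R) (fun s => A s i) (cross3 (xv 1 s) (xv 3 s) i).
Proof.
move=> Is.
have H := is_derive_cross3 i (fun i => is_derive_xD 1 i Is) (fun i => is_derive_xD 2 i Is).
have cc (a : 'I_3 -> R) : cross3 a a i = 0.
  by elim/ord3P: i {H}; rewrite !cross3E; ring.
by move: H; rewrite cc add0r.
Qed.

Lemma is_derive_local_eq (f g : R -> R) s a b : I s -> (forall s, I s -> f s = g s) ->
  is_derive s (1 : R) f a -> is_derive s (1 : R) g b -> a = b.
Proof.
move=> Is fg df dg; rewrite -(is_derive1E df) -(is_derive1E dg).
exact: (derive1_eq_on I_open).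
Qed.

(** The trivial variation, with [phi] and [c] both zero, turns the two-variable results into
    statements about [x] itself; the inner products below are obtained in the same way. *)
Lemma smooth1_kappa_ m : smooth1 I (kappa_ x m).
Proof.
have s0 : smooth1 I (cst 0 : R -> R) := smooth1_cst I 0.
have H := smooth2_slice (open_regular I_open x_smooth s0) I_open
  (smooth2_kappav 0 I_open 0 x_smooth s0 false m)
  (regular0 I_open 0 x_smooth s0 x_arclength x_curved).
by apply: (smooth1_eq I_open _ H) => s Is; rewrite kappav_at0.
Qed.

Lemma smooth1_tau_ m : smooth1 I (tau_ x m).
Proof.
have s0 : smooth1 I (cst 0 : R -> R) := smooth1_cst I 0.
have H := smooth2_slice (open_regular I_open x_smooth s0) I_open
  (smooth2_tauv 0 I_open 0 x_smooth s0 false m)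
  (regular0 I_open 0 x_smooth s0 x_arclength x_curved).
by apply: (smooth1_eq I_open _ H) => s Is; rewrite tauv_at0.
Qed.

Lemma arcD_derive1 f s : I s -> arcD x f s = derive1 f s.
Proof. by move=> Is; rewrite /arcD /speed x_arclength // divr1. Qed.

Lemma smooth1_arcD f : smooth1 I f -> smooth1 I (arcD x f).
Proof.
move=> sf; apply: (smooth1_eq I_open _ (smooth1_derive sf)) => s Is.
by rewrite arcD_derive1.
Qed.

Lemma smooth1_iter_arcD f k : smooth1 I f -> smooth1 I (iter k (arcD x) f).
Proof. by move=> sf; elim: k => //= k; exact: smooth1_arcD. Qed.

Lemma is_derive_arcD f s : smooth1 I f -> I s -> is_derive s (1 : R) f (arcD x f s).
Proof. by move=> sf Is; rewrite arcD_derive1 //; exact: smooth1_is_derive sf Is. Qed.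

Lemma sq_tangent s : I s -> dot3 (xv 1 s) (xv 1 s) = 1.
Proof.
move=> Is; have s0 : smooth1 I (cst 0 : R -> R) := smooth1_cst I 0.
rewrite -(sqspeed0 I_open 0 x_smooth s0 x_arclength Is).
by apply: eq_dot3 => i; rewrite varyD0.
Qed.

Lemma sq_xcross s : I s -> dot3 (A s) (A s) = K s ^+ 2.
Proof.
move=> Is; have s0 : smooth1 I (cst 0 : R -> R) := smooth1_cst I 0.
rewrite -(sqrt_sqcross0 I_open 0 x_smooth s0 x_arclength Is) sqr_sqrtr ?dot3_ge0 //.
by apply: eq_dot3 => i; rewrite vary_cross0.
Qed.

Lemma torsionE s : I s -> dot3 (xv 3 s) (A s) = T s * K s ^+ 2.
Proof.
move=> Is; have s0 : smooth1 I (cst 0 : R -> R) := smooth1_cst I 0.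
have rs := regular0 I_open 0 x_smooth s0 x_arclength x_curved Is.
have := tauv0 I_open x_smooth s0 rs; rewrite tauv_at0 /= => ->.
rewrite (sqrt_sqcross0 I_open 0 x_smooth s0 x_arclength Is) divfK ?expf_neq0 ?x_curved //.
by apply: eq_dot3 => i; rewrite ?varyD0 ?vary_cross0.
Qed.

(** Derivative of |x_s|^2 = 1. Differentiating in turn x_s . x_ss = 0 and |x_ss|^2 = kappa^2 yields
    the products with x_sss. *)
Lemma tangent_accel s : I s -> dot3 (xv 1 s) (xv 2 s) = 0.
Proof.
move=> Is; have H := is_derive_dot3 (fun i => is_derive_xD 1 i Is) (fun i => is_derive_xD 1 i Is).
have := is_derive_local_eq Is sq_tangent H (is_derive_cst (1 : R) s (1 : R^o)).
by rewrite [X in X + _ = _]dot3C; move: (dot3 _ _) => r h; lra.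
Qed.

Lemma lagrange_identity (a b : 'I_3 -> R) :
  dot3 (cross3 a b) (cross3 a b) = dot3 a a * dot3 b b - dot3 a b ^+ 2.
Proof. by rewrite /dot3 !cross3E; ring. Qed.

Lemma sq_accel s : I s -> dot3 (xv 2 s) (xv 2 s) = K s ^+ 2.
Proof.
move=> Is; rewrite -sq_xcross // lagrange_identity sq_tangent // tangent_accel //.
by rewrite mul1r expr0n subr0.
Qed.

Lemma tangent_jerk s : I s -> dot3 (xv 1 s) (xv 3 s) = - K s ^+ 2.
Proof.
move=> Is; have H := is_derive_dot3 (fun i => is_derive_xD 1 i Is) (fun i => is_derive_xD 2 i Is).
have := is_derive_local_eq Is tangent_accel H (is_derive_cst (0 : R) s (1 : R^o)).
by rewrite sq_accel // => /eqP; rewrite addrC addr_eq0 => /eqP.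
Qed.

Lemma is_derive_curvature s : I s -> is_derive s (1 : R) K (arcD x K s).
Proof. by apply: is_derive_arcD; exact: (smooth1_kappa_ 0). Qed.

Lemma accel_jerk s : I s -> dot3 (xv 2 s) (xv 3 s) = K s * arcD x K s.
Proof.
move=> Is; have H := is_derive_dot3 (fun i => is_derive_xD 2 i Is) (fun i => is_derive_xD 2 i Is).
have dK := is_derive_exp 1 (is_derive_curvature Is).
have := is_derive_local_eq Is sq_accel H dK.
rewrite [X in X + _ = _]dot3C expr1.
by move: (dot3 _ _) (K s) (arcD x K s) => r k k1 h; lra.
Qed.

(** Expansion of [w] in the basis a, b, a x b, cleared of its denominator |a x b|^2, the Gram
    determinant of a and b; orthogonality of a and b is not assumed. *)
Lemma frame_expansion (a b w : 'I_3 -> R) i :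
  dot3 (cross3 a b) (cross3 a b) * w i =
    dot3 w (cross3 a b) * cross3 a b i
    + (dot3 a w * dot3 b b - dot3 b w * dot3 a b) * a i
    + (dot3 b w * dot3 a a - dot3 a w * dot3 a b) * b i.
Proof. by elim/ord3P: i; rewrite /dot3 !cross3E; ring. Qed.

Lemma frame_coordinates (a b w : 'I_3 -> R) (k k1 t : R) i : k != 0 ->
  dot3 (cross3 a b) (cross3 a b) = k ^+ 2 -> dot3 w (cross3 a b) = t * k ^+ 2 ->
  dot3 a w = - k ^+ 2 -> dot3 b w = k * k1 ->
  dot3 a a = 1 -> dot3 a b = 0 -> dot3 b b = k ^+ 2 ->
  w i = - k ^+ 2 * a i + k1 / k * b i + t * cross3 a b i.
Proof.
move=> k0 eA ewA eaw ebw eaa eab ebb; apply: (mulfI (expf_neq0 2 k0)).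
rewrite -{1}eA frame_expansion ewA eaw ebw eaa eab ebb.
by field.
Qed.

(** Frenet's N' = - kappa T + tau B, written in the unnormalized frame x_s = T, x_ss = kappa N, x_s
    x x_ss = kappa B. *)
Lemma jerkE s i : I s -> xD x 3 i s =
  - K s ^+ 2 * xD x 1 i s + arcD x K s / K s * xD x 2 i s + T s * A s i.
Proof.
move=> Is.
exact: (frame_coordinates (w := xv 3 s) i (x_curved Is) (sq_xcross Is) (torsionE Is)
  (tangent_jerk Is) (accel_jerk Is) (sq_tangent Is) (tangent_accel Is) (sq_accel Is)).
Qed.

Lemma cross3_frame (a b w : 'I_3 -> R) (l m t : R) i :
  (forall i, w i = l * a i + m * b i + t * cross3 a b i) ->
  dot3 a a = 1 -> dot3 a b = 0 ->
  cross3 a w i = m * cross3 a b i - t * b i.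
Proof.
move=> ew eaa eab.
(* The double cross product a x (a x b) = (a . b) a - (a . a) b. *)
transitivity (m * cross3 a b i + t * (dot3 a b * a i - dot3 a a * b i)).
  by elim/ord3P: i; rewrite /dot3 !cross3E !ew !cross3E; ring.
by rewrite eaa eab; ring.
Qed.

Lemma dxcrossE s i : I s -> cross3 (xv 1 s) (xv 3 s) i =
  arcD x K s / K s * A s i - T s * xD x 2 i s.
Proof.
move=> Is.
exact: (cross3_frame i (fun i => jerkE i Is) (sq_tangent Is) (tangent_accel Is)).
Qed.

Lemma is_derive_binormal i s : I s -> is_derive s (1 : R) (fun s => A s i)
  (arcD x K s / K s * A s i - T s * xD x 2 i s).
Proof. by move=> Is; exact: (is_derive_eq (is_derive_xcross i Is) (dxcrossE i Is)). Qed.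

Lemma is_derive_accel i s : I s -> is_derive s (1 : R) (xD x 2 i)
  (- K s ^+ 2 * xD x 1 i s + arcD x K s / K s * xD x 2 i s + T s * A s i).
Proof. by move=> Is; exact: (is_derive_eq (is_derive_xD 2 i Is) (jerkE i Is)). Qed.

End Frenet.

(** * The force and its work *)

Section Telescope.
Variable R : realType.

Lemma is_derive_scale (a : R) (f : R -> R) (t df : R) :
  is_derive t (1 : R) f df -> is_derive t (1 : R) (fun s => a * f s) (a * df).
Proof.
move=> hf; apply: (is_derive_eq (is_derive_mul (is_derive_cst a t (1 : R^o)) hf)).
by rewrite mulr0 addr0.
Qed.

Lemma is_derive_bigsum (T : Type) (r : seq T) (f : T -> R -> R) (df : T -> R) (t : R) :
  (forall i, is_derive t (1 : R) (f i) (df i)) ->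
  is_derive t (1 : R) (fun s => \sum_(i <- r) f i s) (\sum_(i <- r) df i).
Proof.
move=> hf; elim: r => [|i r IHr].
  have -> : (fun s => \sum_(i <- [::]) f i s) = (fun=> 0).
    by apply/funext => s; rewrite big_nil.
  by rewrite big_nil; exact: is_derive_cst.
have -> : (fun s => \sum_(j <- i :: r) f j s) = (fun s => f i s + \sum_(j <- r) f j s).
  by apply/funext => s; rewrite big_cons.
by rewrite big_cons; exact: is_derive_add.
Qed.

(* Repeated integration by parts, with [eps] the failure of the variation to
   commute with the arc length derivative. *)
Lemma is_derive_boundary (m : nat) (u k d : nat -> R -> R) (eps s : R) :
  (forall i, is_derive s (1 : R) (u i) (u i.+1 s)) ->
  (forall i, is_derive s (1 : R) (d i) (d i.+1 s + eps * k i.+1 s)) ->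
  is_derive s (1 : R) (fun s => \sum_(i < m) (-1) ^+ i * u i s * d (m - i.+1)%N s)
    (u 0%N s * d m s - (-1) ^+ m * u m s * d 0%N s
     + eps * \sum_(i < m) (-1) ^+ i * u i s * k (m - i)%N s).
Proof.
move=> hu hd.
(* The alternating sign turns each derivative into minus a difference of consecutive terms, plus the
   commutator term; the differences telescope from 0 to m. *)
have H (i : 'I_m) : is_derive s (1 : R) (fun s => (-1) ^+ i * u i s * d (m - i.+1)%N s)
    (- ((-1) ^+ i.+1 * u i.+1 s * d (m - i.+1)%N s - (-1) ^+ i * u i s * d (m - i)%N s)
     + eps * ((-1) ^+ i * u i s * k (m - i)%N s)).
  apply: (is_derive_eq (is_derive_mul (is_derive_scale ((-1) ^+ i) (hu i))
    (hd (m - i.+1)%N))).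
  by rewrite subnSK // exprS; ring.
apply: (is_derive_eq (is_derive_bigsum _ H)).
rewrite big_split /= mulr_sumr; congr (_ + _).
rewrite sumrN -(big_mkord xpredT (fun i => (-1) ^+ i.+1 * u i.+1 s * d (m - i.+1)%N s
  - (-1) ^+ i * u i s * d (m - i)%N s)).
rewrite (telescope_sumr (fun i => (-1) ^+ i * u i s * d (m - i)%N s)) //.
by rewrite subnn subn0 expr0 mul1r; ring.
Qed.

End Telescope.

Section Force.
Variables (R : realType) (n : nat) (U : set (jets R n)) (L : jets R n -> R).
Variables (I : set R) (x : R -> 'cV[R]_3).
Hypothesis L_smooth : smooth_on U L.
Hypothesis I_open : open I.
Hypothesis x_smooth : smooth_on I x.
Hypothesis x_arclength : forall s, I s -> enorm (derive1 x s) = 1.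
Hypothesis x_curved : forall s, I s -> curvature x s != 0.
Hypothesis x_jets : forall s, I s -> U (jet n x s).

Local Notation K := (curvature x).
Local Notation T := (torsion x).
Local Notation Ds := (arcD x).
Local Notation Ek := (Euler_kappa L x).
Local Notation Et := (Euler_tau L x).
Local Notation Lk m := (fun r => dL_kappa L m (jet n x r)).
Local Notation Lt m := (fun r => dL_tau L m (jet n x r)).

(** Composition with [G] gives up symmetry of mixed partials, which smoothness in [s] alone does not
    use: hence the flag [true]. *)
Lemma smooth1_jet (G : jets R n -> R) : smooth_on U G -> smooth1 I (fun s => G (jet n x s)).
Proof.
move=> sG; apply: (@smooth2_smooth1 _ _ I_open n true).
apply: (@smooth2_comp R n true (cylinder I) U G (fun i p => kappa_ x i p.2)
  (fun i p => tau_ x i p.2)) => //.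
- by move=> i; apply: smooth1_smooth2 => //; exact: smooth1_kappa_.
- by move=> i; apply: smooth1_smooth2 => //; exact: smooth1_tau_.
- by move=> p; exact: x_jets.
Qed.

Lemma smooth1_Lk m : smooth1 I (Lk m).
Proof. by apply: (smooth1_jet (G := dL_kappa L m)); exact: smooth_on_derive. Qed.

Lemma smooth1_Lt m : smooth1 I (Lt m).
Proof. by apply: (smooth1_jet (G := dL_tau L m)); exact: smooth_on_derive. Qed.

Lemma smooth1_scale (a : R) f : smooth1 I f -> smooth1 I (fun s => a * f s).
Proof. by move=> sf; apply: smooth1_mul => //; exact: smooth1_cst. Qed.

Lemma smooth1_Euler_kappa : smooth1 I Ek.
Proof.
apply: (smooth1_sum I_open) => m; apply: smooth1_scale.
by apply: (smooth1_iter_arcD I_open x_arclength); exact: smooth1_Lk.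
Qed.

Lemma smooth1_Euler_tau : smooth1 I Et.
Proof.
apply: (smooth1_sum I_open) => m; apply: smooth1_scale.
by apply: (smooth1_iter_arcD I_open x_arclength); exact: smooth1_Lt.
Qed.

Definition boundary_kappa s := \sum_(m < n.+1) \sum_(i < m)
  (-1) ^+ i * iter i Ds (Lk m) s * kappa_ x (m - i) s.
Definition boundary_tau s := \sum_(m < n.+1) \sum_(i < m)
  (-1) ^+ i * iter i Ds (Lt m) s * tau_ x (m - i) s.

(** For m = 0 the inner sums are empty, so the restriction to m >= 1 may be dropped. *)
Lemma lambdaE s : lambda L x s =
  2 * T s * Et s - L (jet n x s) + boundary_kappa s + boundary_tau s.
Proof.
have drop0 (f : 'I_n.+1 -> R) : (forall m : 'I_n.+1, (m < 1)%N -> f m = 0) ->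
    \sum_(m < n.+1 | (1 <= m)%N) f m = \sum_(m < n.+1) f m.
  move=> f0; rewrite [RHS](bigID (fun m : 'I_n.+1 => (1 <= m)%N)) /=.
  rewrite [X in _ = _ + X]big1 ?addr0 // => m.
  by rewrite -ltnNge => /f0.
have e0 m (g : 'I_m -> R) : (m < 1)%N -> \sum_(i < m) g i = 0.
  by case: m g => // g _; rewrite big_ord0.
by rewrite /lambda !drop0 // => m; exact: e0.
Qed.

Lemma smooth1_boundary (f : 'I_n.+1 -> R -> R) (k : nat -> R -> R) :
  (forall m, smooth1 I (f m)) -> (forall m, smooth1 I (k m)) ->
  smooth1 I (fun s => \sum_(m < n.+1) \sum_(i < m)
    (-1) ^+ i * iter i Ds (f m) s * k (m - i)%N s).
Proof.
move=> sf sk; apply: (smooth1_sum I_open) => m; apply: (smooth1_sum I_open) => i.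
by apply: (smooth1_mul I_open) => //; apply: smooth1_scale;
  exact: (smooth1_iter_arcD I_open x_arclength).
Qed.

Lemma smooth1_lambda : smooth1 I (lambda L x).
Proof.
have H : smooth1 I (fun s => 2 * T s * Et s + - L (jet n x s) + boundary_kappa s + boundary_tau s).
  apply: (smooth1_add I_open); last first.
    by apply: smooth1_boundary => m; [exact: smooth1_Lt|exact: smooth1_tau_].
  apply: (smooth1_add I_open); last first.
    by apply: smooth1_boundary => m; [exact: smooth1_Lk|exact: smooth1_kappa_].
  apply: (smooth1_add I_open).
    apply: (smooth1_mul I_open); last exact: smooth1_Euler_tau.
    by apply: smooth1_scale; exact: (smooth1_tau_ _ _ _ _ 0).
  by apply: (smooth1_opp I_open); exact: smooth1_jet.
by apply: (smooth1_eq I_open _ H) => s _; rewrite lambdaE.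
Qed.

Definition force1 s := T s * Et s - K s * Ek s - lambda L x s.
Definition force2 s := - Ds Ek s - T s / K s * Ds Et s.
Definition force3 s := (K s)^-1 * Ds (Ds Et) s - Ds K s / K s ^+ 2 * Ds Et s
  + K s * Et s - T s * Ek s.

(** The vector F1 T + F2 N + F3 B; the divisions by [K s] normalize x_ss = kappa N and [xcross] =
    kappa B. *)
Definition force (i : 'I_3) s :=
  force1 s * xD x 1 i s + force2 s / K s * xD x 2 i s + force3 s / K s * xcross x s i.

Let sK : smooth1 I K := smooth1_kappa_ I_open x_smooth x_arclength x_curved 0.
Let sT : smooth1 I T := smooth1_tau_ I_open x_smooth x_arclength x_curved 0.

Lemma smooth1_curvatureV : smooth1 I (fun s => (K s)^-1).
Proof. exact: smooth1_inv. Qed.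

Lemma smooth1_sub f g : smooth1 I f -> smooth1 I g -> smooth1 I (fun s => f s - g s).
Proof. by move=> sf sg; apply: (smooth1_add I_open) => //; exact: smooth1_opp. Qed.

Lemma smooth1_xcross i : smooth1 I (fun s => xcross x s i).
Proof.
have sx k j := smooth1_xD I_open x_smooth k j.
by elim/ord3P: i; apply: smooth1_sub; apply: (smooth1_mul I_open).
Qed.

Lemma smooth1_force i : smooth1 I (force i).
Proof.
have sE := smooth1_Euler_kappa; have sF := smooth1_Euler_tau.
have sV := smooth1_curvatureV; have sl := smooth1_lambda.
have D f : smooth1 I f -> smooth1 I (Ds f) by exact: smooth1_arcD.
have M f g : smooth1 I f -> smooth1 I g -> smooth1 I (fun s => f s * g s).
  exact: smooth1_mul.
have P f g : smooth1 I f -> smooth1 I g -> smooth1 I (fun s => f s + g s).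
  exact: smooth1_add.
have sV2 : smooth1 I (fun s => (K s ^+ 2)^-1).
  by apply: (smooth1_eq I_open _ (M _ _ sV sV)) => s _; rewrite -exprVn expr2.
apply: (P); first apply: (P); apply: (M).
- by apply: smooth1_sub => //; apply: smooth1_sub; exact: M.
- exact: smooth1_xD.
- apply: (M) => //; apply: smooth1_sub; last by apply: (M _ _ (M _ _ sT sV)); exact: D.
  by apply: (smooth1_opp I_open); exact: D.
- exact: smooth1_xD.
- apply: (M) => //; apply: smooth1_sub; last exact: M.
  apply: (P); last exact: M.
  apply: smooth1_sub; first by apply: (M) => //; exact: D (D _ _).
  by apply: (M _ _ (M _ _ (D _ sK) sV2)); exact: D.
- exact: smooth1_xcross.
Qed.

End Force.

(** * Vector identities and cancellations behind the first variation *)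

Section CrossAlgebra.
Variable R : realType.
Implicit Types a b w e : 'I_3 -> R.

Lemma dot3_crossD a b e1 e2 :
  dot3 (cross3 a b) (fun i => cross3 e1 b i + cross3 a e2 i) =
  dot3 b b * dot3 a e1 - dot3 a b * dot3 b e1
  + dot3 a a * dot3 b e2 - dot3 a b * dot3 a e2.
Proof. by rewrite /dot3 !cross3E; ring. Qed.

Lemma dot3_frame a b w e (l m t : R) :
  (forall i, w i = l * a i + m * b i + t * cross3 a b i) ->
  dot3 w e = l * dot3 a e + m * dot3 b e + t * dot3 (cross3 a b) e.
Proof. by move=> ew; rewrite /dot3 !ew; ring. Qed.

Lemma dot3_comb2 a b w e (l m : R) :
  (forall i, w i = l * a i - m * b i) -> dot3 w e = l * dot3 a e - m * dot3 b e.
Proof. by move=> ew; rewrite /dot3 !ew; ring. Qed.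

Lemma dot3_tangent_crossD a b e1 e2 :
  dot3 a (fun i => cross3 e1 b i + cross3 a e2 i) = - dot3 (cross3 a b) e1.
Proof. by rewrite /dot3 !cross3E; ring. Qed.

Lemma dot3_accel_crossD a b e1 e2 :
  dot3 b (fun i => cross3 e1 b i + cross3 a e2 i) = - dot3 (cross3 a b) e2.
Proof. by rewrite /dot3 !cross3E; ring. Qed.

(** Meant for p_j = (x_s x x_ss) . eta_(j+1), q = x_ss . eta_2, e = [stretch], while X and Y are the
    products of [dcross] with x_s x x_ss and with x_sss. *)
Lemma dtau_algebra (k k1 t e q p0 p1 p2 X Y : R) : k != 0 ->
  X = k ^+ 2 * e + q -> Y = - k ^+ 2 * - p0 + k1 / k * - p1 + t * X ->
  (p2 + Y) / k ^+ 2 - 2 * t * (X / k) / k =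
  p2 / k ^+ 2 - k1 / k ^+ 3 * p1 + p0 - t / k ^+ 2 * q - t * e.
Proof. by move=> k0 -> ->; field. Qed.

(** Here p_j = (x_s x x_ss) . eta_(j+1) and q_j = x_ss . eta_(j+1) carry phi^(j+1), and e is
    [stretch]. The coefficients of p2, p1 and q1 cancel. What remains is linear in e, q0 and p0,
    hence in phi', and its coefficients are minus the components of the force, apart from l e;
    [lambda] enters the coefficient of e. *)
Lemma flux_algebra (Sk St Ek Et dk0 dt0 e bk bt l k k1 t E1 E2 G1 p0 p1 p2 q0 q1 lam Fe : R) :
  k != 0 -> dk0 = q1 / k - 2 * k * e ->
  dt0 = p2 / k ^+ 2 - k1 / k ^+ 3 * p1 + p0 - t / k ^+ 2 * q1 - t * e ->
  lam = 2 * t * Et - l + bk + bt ->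
  Fe = (t * Et - k * Ek - lam) * e + (- G1 - t / k * E1) / k * q0
    + (k^-1 * E2 - k1 / k ^+ 2 * E1 + k * Et - t * Ek) / k * p0 ->
  let kk := k^-1 * k^-1 in
  let vd := - k1 * k^-1 * k^-1 in
  let dkk := k^-1 * vd + k^-1 * vd in
  (Sk - Ek * dk0 + e * bk) + (St - Et * dt0 + e * bt)
  + ((Et * kk) * (k1 / k * p1 - t * q1 + p2) + p1 * (Et * dkk + kk * E1)
     - ((E1 * kk) * (k1 / k * p0 - t * q0 + p1) + p0 * (E1 * dkk + kk * E2))
     + ((Ek * k^-1) * (- k ^+ 2 * e + k1 / k * q0 + t * p0 + q1)
        + q0 * (Ek * vd + k^-1 * G1)))
  = Sk + St + l * e - Fe.
Proof. by move=> k0 -> -> -> -> /=; field. Qed.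

End CrossAlgebra.

(** * The first variation of the Lagrangian as work of the force plus the derivative of a flux *)

Section FirstVariation.
Variables (R : realType) (n : nat) (U : set (jets R n)) (L : jets R n -> R).
Variables (I : set R) (x : R -> 'cV[R]_3) (phi : R -> R) (c : 'cV[R]_3).
Hypothesis L_smooth : smooth_on U L.
Hypothesis I_open : open I.
Hypothesis x_smooth : smooth_on I x.
Hypothesis x_arclength : forall s, I s -> enorm (derive1 x s) = 1.
Hypothesis x_curved : forall s, I s -> curvature x s != 0.
Hypothesis x_jets : forall s, I s -> U (jet n x s).
Hypothesis phi_smooth : smooth1 I phi.

Local Notation K := (curvature x).
Local Notation T := (torsion x).
Local Notation Ds := (arcD x).
Local Notation Ek := (Euler_kappa L x).
Local Notation Et := (Euler_tau L x).
Local Notation Lk m := (fun r => dL_kappa L m (jet n x r)).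
Local Notation Lt m := (fun r => dL_tau L m (jet n x r)).
Local Notation A := (xcross x).
Local Notation xv k s := (fun i => xD x k i s).
Local Notation ev k s := (fun i => eta phi c k i s).
Local Notation eps := (stretch x phi c).

Definition dkappa m s := partial_e (kappav x phi c m) (0, s).
Definition dtau m s := partial_e (tauv x phi c m) (0, s).

Let ro := open_regular (c := c) I_open x_smooth phi_smooth.
Let r0 := regular0 I_open c x_smooth phi_smooth x_arclength x_curved.

Lemma smooth1_dkappa m : smooth1 I (dkappa m).
Proof.
apply: (smooth2_slice ro I_open _ r0).
exact: smooth2_partial_e ro _ (smooth2_kappav n I_open c x_smooth phi_smooth false m).
Qed.

Lemma smooth1_dtau m : smooth1 I (dtau m).
Proof.
apply: (smooth2_slice ro I_open _ r0).
exact: smooth2_partial_e ro _ (smooth2_tauv n I_open c x_smooth phi_smooth false m).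
Qed.

Lemma is_derive_dkappa m s : I s ->
  is_derive s (1 : R) (dkappa m) (dkappa m.+1 s + eps s * kappa_ x m.+1 s).
Proof.
move=> Is; apply: (is_derive_eq (smooth1_is_derive (smooth1_dkappa m) Is)).
rewrite [dkappa m.+1 s](partial_e_kappavS 0 I_open c x_smooth phi_smooth x_arclength x_curved m Is).
by rewrite subrK.
Qed.

Lemma is_derive_dtau m s : I s ->
  is_derive s (1 : R) (dtau m) (dtau m.+1 s + eps s * tau_ x m.+1 s).
Proof.
move=> Is; apply: (is_derive_eq (smooth1_is_derive (smooth1_dtau m) Is)).
rewrite [dtau m.+1 s](partial_e_tauvS 0 I_open c x_smooth phi_smooth x_arclength x_curved m Is).
by rewrite subrK.
Qed.

Lemma is_derive_boundary_sum (f : 'I_n.+1 -> R -> R) (k d : nat -> R -> R) s :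
  I s -> (forall m, smooth1 I (f m)) ->
  (forall i, is_derive s (1 : R) (d i) (d i.+1 s + eps s * k i.+1 s)) ->
  is_derive s (1 : R)
    (fun s => \sum_(m < n.+1) \sum_(i < m) (-1) ^+ i * iter i Ds (f m) s * d (m - i.+1)%N s)
    (\sum_(m < n.+1) d m s * f m s
     - (\sum_(m < n.+1) (-1) ^+ m * iter m Ds (f m) s) * d 0%N s
     + eps s * \sum_(m < n.+1) \sum_(i < m) (-1) ^+ i * iter i Ds (f m) s * k (m - i)%N s).
Proof.
move=> Is sf hd.
have hu (m : 'I_n.+1) i : is_derive s (1 : R) (iter i Ds (f m)) (iter i.+1 Ds (f m) s).
  by apply: is_derive_arcD Is => //; exact: smooth1_iter_arcD.
have H := is_derive_bigsum (index_enum 'I_n.+1)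
  (fun m : 'I_n.+1 => is_derive_boundary (u := fun i => iter i Ds (f m)) m (hu m) hd).
apply: (is_derive_eq H); rewrite big_split /= mulr_sumr; congr (_ + _).
rewrite big_split sumrN mulr_suml /=; congr (_ - _).
by apply: eq_bigr => m _; rewrite mulrC.
Qed.

(** The double sums are the boundary terms of moving D_s off the variations of kappa_m and tau_m.
    The last group moves derivatives off phi''' and phi'': its leading coefficients E^tau / kappa^2
    and E^kappa / kappa are those of phi''' in E^tau dtau_0 and of x_ss . eta_2 in E^kappa
    dkappa_0. *)
Definition noether_flux s :=
  \sum_(m < n.+1) \sum_(i < m) (-1) ^+ i * iter i Ds (Lk m) s * dkappa (m - i.+1)%N s
  + \sum_(m < n.+1) \sum_(i < m) (-1) ^+ i * iter i Ds (Lt m) s * dtau (m - i.+1)%N s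
  + (Et s * ((K s)^-1 * (K s)^-1) * dot3 (A s) (ev 2 s)
     - Ds Et s * ((K s)^-1 * (K s)^-1) * dot3 (A s) (ev 1 s)
     + Ek s * (K s)^-1 * dot3 (xv 2 s) (ev 1 s)).

Definition first_variation s :=
  \sum_(m < n.+1) dkappa m s * Lk m s + \sum_(m < n.+1) dtau m s * Lt m s
  + L (jet n x s) * eps s.

Lemma is_derive_eta k i s : I s -> is_derive s (1 : R) (eta phi c k i) (eta phi c k.+1 i s).
Proof.
move=> Is; have dp := smooth1_is_derive (smooth1_derive1n k phi_smooth) Is.
have := is_derive_scale (c i 0) dp.
rewrite (_ : (fun s => c i 0 * derive1n k phi s) = eta phi c k i); last first.
  by apply/funext => t; rewrite /eta mulrC.
by rewrite /eta derive1nS mulrC.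
Qed.

Lemma crossD_at s : I s ->
  dot3 (A s) (dcross x phi c s) = K s ^+ 2 * eps s + dot3 (xv 2 s) (ev 2 s).
Proof.
move=> Is; apply: (etrans (dot3_crossD _ _ _ _)).
rewrite (sq_tangent I_open x_smooth x_arclength Is) (tangent_accel I_open x_smooth x_arclength Is).
rewrite (sq_accel I_open x_smooth x_arclength Is) -/(eps s).
by rewrite !mul0r !subr0 mul1r.
Qed.

(** The classical N . eta_ss - 2 kappa stretch: the cubed speed contributes -3 kappa stretch, and
    the cross product gives one kappa stretch back. *)
Lemma dkappa0E s : I s ->
  dkappa 0 s = dot3 (xv 2 s) (ev 2 s) / K s - 2 * K s * eps s.
Proof.
move=> Is; have k0 := x_curved Is.
rewrite [LHS](partial_e_kappav0 I_open c x_smooth phi_smooth x_arclength x_curved Is).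
rewrite crossD_at //; move: (dot3 (xv 2 s) (ev 2 s)) (eps s) => q e.
move: k0; move: (K s) => k k0.
by field.
Qed.

(** Expanding x_sss by [jerkE] leaves only products of derivatives of the variation field with the
    three frame vectors. *)
Lemma dtau0E s : I s -> dtau 0 s =
  dot3 (A s) (ev 3 s) / K s ^+ 2 - Ds K s / K s ^+ 3 * dot3 (A s) (ev 2 s)
  + dot3 (A s) (ev 1 s) - T s / K s ^+ 2 * dot3 (xv 2 s) (ev 2 s) - T s * eps s.
Proof.
move=> Is; have k0 := x_curved Is.
rewrite [LHS](partial_e_tauv0 I_open c x_smooth phi_smooth x_arclength x_curved Is).
have E : dot3 (xv 3 s) (dcross x phi c s) =
    - K s ^+ 2 * - dot3 (A s) (ev 1 s) + Ds K s / K s * - dot3 (A s) (ev 2 s)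
    + T s * dot3 (A s) (dcross x phi c s).
  apply: (etrans (dot3_frame _
    (fun i => jerkE I_open x_smooth x_arclength x_curved i Is))).
  congr (_ * _ + _ * _ + _); first exact: dot3_tangent_crossD.
  exact: dot3_accel_crossD.
rewrite (dot3C (ev 3 s) (A s)).
exact: (dtau_algebra (dot3 (A s) (ev 3 s)) k0 (crossD_at Is) E).
Qed.

Lemma is_derive_A_eta k s : I s ->
  is_derive s (1 : R) (fun s => dot3 (A s) (ev k s))
   (Ds K s / K s * dot3 (A s) (ev k s) - T s * dot3 (xv 2 s) (ev k s) + dot3 (A s) (ev k.+1 s)).
Proof.
move=> Is; have H := is_derive_dot3
  (fun i => is_derive_binormal I_open x_smooth x_arclength x_curved i Is)
  (fun i => is_derive_eta k i Is).
apply: (is_derive_eq H); congr (_ + _).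
by apply: dot3_comb2 => i.
Qed.

Lemma is_derive_b_eta k s : I s ->
  is_derive s (1 : R) (fun s => dot3 (xv 2 s) (ev k s))
   (- K s ^+ 2 * dot3 (xv 1 s) (ev k s) + Ds K s / K s * dot3 (xv 2 s) (ev k s)
    + T s * dot3 (A s) (ev k s) + dot3 (xv 2 s) (ev k.+1 s)).
Proof.
move=> Is; have H := is_derive_dot3
  (fun i => is_derive_accel I_open x_smooth x_arclength x_curved i Is)
  (fun i => is_derive_eta k i Is).
apply: (is_derive_eq H); congr (_ + _).
by apply: dot3_frame => i.
Qed.

Let sEk := smooth1_Euler_kappa L_smooth I_open x_smooth x_arclength x_curved x_jets.
Let sEt := smooth1_Euler_tau L_smooth I_open x_smooth x_arclength x_curved x_jets.

Lemma dot3_force s (e : 'I_3 -> R) : dot3 (fun i => force L x i s) e =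
  force1 L x s * dot3 (xv 1 s) e + force2 L x s / K s * dot3 (xv 2 s) e
  + force3 L x s / K s * dot3 (A s) e.
Proof. exact: dot3_frame. Qed.

(** An identity for every curve, extremal or not: the product rule differentiates the five groups of
    the flux, and [flux_algebra] is the resulting cancellation. *)
Lemma is_derive_noether_flux s : I s -> is_derive s (1 : R) noether_flux
  (first_variation s - dot3 (fun i => force L x i s) (ev 1 s)).
Proof.
move=> Is; have k0 := x_curved Is.
have D1 : is_derive s (1 : R) _ (\sum_(m < n.+1) dkappa m s * Lk m s
    - Ek s * dkappa 0 s + eps s * boundary_kappa L x s) :=
  is_derive_boundary_sum (f := fun m => Lk m) Is
    (smooth1_Lk L_smooth I_open x_smooth x_arclength x_curved x_jets)
    (fun i => is_derive_dkappa i Is).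
have D2 : is_derive s (1 : R) _ (\sum_(m < n.+1) dtau m s * Lt m s
    - Et s * dtau 0 s + eps s * boundary_tau L x s) :=
  is_derive_boundary_sum (f := fun m => Lt m) Is
    (smooth1_Lt L_smooth I_open x_smooth x_arclength x_curved x_jets)
    (fun i => is_derive_dtau i Is).
have dEt := is_derive_arcD x_arclength sEt Is.
have dEt1 := is_derive_arcD x_arclength (smooth1_arcD I_open x_arclength sEt) Is.
have dEk := is_derive_arcD x_arclength sEk Is.
have dV := is_derive_inv k0 (is_derive_curvature I_open x_smooth x_arclength x_curved Is).
have dVV := is_derive_mul dV dV.
have D3 := is_derive_mul (is_derive_mul dEt dVV) (is_derive_A_eta 2 Is).
have D4 := is_derive_mul (is_derive_mul dEt1 dVV) (is_derive_A_eta 1 Is).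
have D5 := is_derive_mul (is_derive_mul dEk dV) (is_derive_b_eta 1 Is).
have D := is_derive_add (is_derive_add D1 D2) (is_derive_add (is_derive_sub D3 D4) D5).
have alg := flux_algebra (\sum_(m < n.+1) dkappa m s * Lk m s)
  (\sum_(m < n.+1) dtau m s * Lt m s) k0 (dkappa0E Is) (dtau0E Is) (lambdaE L x s)
  (dot3_force s (ev 1 s)).
exact: (is_derive_eq D alg).
Qed.

End FirstVariation.

(** * Differentiation of the action *)

Section Integrals.
Variable R : realType.
Local Notation mu := (@lebesgue_measure R).
Implicit Types (f F : R -> R) (a b : R).

Lemma continuous_in_within (D : set R) f :
  (forall s, D s -> {for s, continuous f}) -> {within D, continuous f}.
Proof.
move=> cf; apply: continuous_in_subspaceT => s; rewrite inE; exact: cf.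
Qed.

Lemma continuous_integrable_itv f a b :
  (forall s, a <= s <= b -> {for s, continuous f}) ->
  mu.-integrable `[a, b] (EFin \o f).
Proof.
move=> cf; apply: continuous_compact_integrable; first exact: segment_compact.
by apply: continuous_in_within => s /=; rewrite in_itv /=; exact: cf.
Qed.

Lemma Rintegral_is_derive f F a b : a < b ->
  (forall s, a <= s <= b -> {for s, continuous f}) ->
  (forall s, a <= s <= b -> is_derive s (1 : R) F (f s)) ->
  \int[mu]_(s in `[a, b]) f s = F b - F a.
Proof.
move=> ab cf dF.
have cF s : a <= s <= b -> {for s, continuous F}.
  move=> /dF df; apply: differentiable_continuous.
  by apply/derivable1_diffP; exact: df.(ex_derive).
have oo s : s \in `]a, b[%R -> a <= s <= b.
  by rewrite in_itv /= => /andP[sa sb]; rewrite !ltW.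
have cw : {within `[a, b], continuous f}.
  by apply: continuous_in_within => s /=; rewrite in_itv /=; exact: cf.
have lr : derivable_oo_LRcontinuous F a b.
  split.
  + by move=> s /oo /dF df; exact: df.(ex_derive).
  + by apply: cvg_at_right_filter; apply: cF; rewrite lexx ltW.
  + by apply: cvg_at_left_filter; apply: cF; rewrite lexx ltW.
have dFf : {in `]a, b[%R, derive1 F =1 f} by move=> s /oo /dF df; exact: is_derive1E.
by rewrite /Rintegral (continuous_FTC2 ab cw lr dFf).
Qed.

(** A vanishing integral forces [f] to vanish almost everywhere; without a zero in ]c, d[ this
    interval would lie in a null set. *)
Lemma Rintegral_ge0_eq0 f a b c d : a <= c -> c < d -> d <= b ->
  (forall s, a <= s <= b -> {for s, continuous f}) ->
  (forall s, a <= s <= b -> 0 <= f s) ->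
  \int[mu]_(s in `[a, b]) f s = 0 -> exists2 s, c < s < d & f s = 0.
Proof.
move=> ac cd db cf f0 if0.
have intf := continuous_integrable_itv cf.
have mf := measurable_int _ intf.
have mI : @measurable _ (measurableTypeR R) `[a, b]%classic by exact: measurable_itv.
have fin := integrable_fin_num mI intf.
have f0E := fineK fin; rewrite [fine _]if0 in f0E.
have aef : ae_eq mu `[a, b] (EFin \o f) (cst 0%E).
  apply/(ae_eq_integral_abs mu mI mf).
  rewrite [RHS]f0E; apply: eq_integral => s; rewrite inE /= in_itv /= => sab.
  by rewrite ger0_norm // f0.
have [Z [mZ Z0 fZ]] := aef.
apply: contrapT => nex.
have sub : `]c, d[%classic `<=` Z.
  move=> s /=; rewrite in_itv /= => sab; apply: fZ => /= fs; apply: nex.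
  exists s => //; have /fs : (`[a, b]%classic : set R) s.
    rewrite /= in_itv /=; case/andP: sab => sa sb.
    by rewrite (le_trans ac (ltW sa)) (le_trans (ltW sb) db).
  by move=> [].
have : (mu `]c, d[%classic <= 0)%E.
  by rewrite -Z0; apply: le_measure => //; rewrite inE.
rewrite lebesgue_measure_itv /= lte_fin cd -EFinB lee_fin subr_le0.
by rewrite leNgt cd.
Qed.

End Integrals.

Section ActionDerivative.
Variables (R : realType) (n : nat) (U : set (jets R n)) (L : jets R n -> R).
Variables (I : set R) (x : R -> 'cV[R]_3) (phi : R -> R) (c : 'cV[R]_3).
Hypothesis U_open : open U.
Hypothesis L_smooth : smooth_on U L.
Hypothesis I_open : open I.
Hypothesis x_smooth : smooth_on I x.
Hypothesis x_arclength : forall s, I s -> enorm (derive1 x s) = 1.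
Hypothesis x_curved : forall s, I s -> curvature x s != 0.
Hypothesis x_jets : forall s, I s -> U (jet n x s).
Hypothesis phi_smooth : smooth1 I phi.

Local Notation regular := (regular I x phi c).
Local Notation mu := (@lebesgue_measure R).

Definition vjet (p : R * R) : jets R n := jet n (fun s => vary x phi c (p.1, s)) p.2.

Definition lagrangian (p : R * R) : R :=
  L (vjet p) * speed (fun s => vary x phi c (p.1, s)) p.2.

(** Besides regularity, the jet of the varied curve has to stay in the domain of [L]. *)
Definition admissible := [set p | regular p /\ U (vjet p)].

Let ro := open_regular (c := c) I_open x_smooth phi_smooth.

Lemma open_admissible : open admissible.
Proof.
rewrite openE => p [rp Up].
have ck : {for p, continuous (fun p => \row_(m < n.+1) kappav x phi c m p : 'rV[R]_n.+1)}.
  apply: row_continuous => m.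
  exact: (smooth2_continuous ro (smooth2_kappav n I_open c x_smooth phi_smooth false m) rp).
have ct : {for p, continuous (fun p => \row_(m < n.+1) tauv x phi c m p : 'rV[R]_n.+1)}.
  apply: row_continuous => m.
  exact: (smooth2_continuous ro (smooth2_tauv n I_open c x_smooth phi_smooth false m) rp).
have cj : {for p, continuous vjet} by exact: (cvg_pair ck ct).
have nU : \forall q \near p, U (vjet q).
  by apply: cj; apply: open_nbhs_nbhs; split.
have nr : \forall q \near p, regular q by apply: open_nbhs_nbhs; split.
rewrite /interior; near=> q; split; near: q; [exact: nr|exact: nU].
Unshelve. all: by end_near. Qed.

Lemma admissible0 s : I s -> admissible (0, s).
Proof.
move=> Is; split; first exact: regular0.
by rewrite /vjet /= vary0; exact: x_jets.
Qed.

Lemma smooth2_lagrangian : @smooth2 R n true admissible lagrangian.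
Proof.
have sub : admissible `<=` regular by move=> p [].
have sj : @smooth2 R n true admissible
    (fun p => L (\row_m kappav x phi c m p, \row_m tauv x phi c m p)).
  apply: (@smooth2_comp R n true admissible U L (fun i => kappav x phi c i)
    (fun i => tauv x phi c i)) => //.
  - by move=> i; apply: (smooth2_subset sub); exact: smooth2_kappav.
  - by move=> i; apply: (smooth2_subset sub); exact: smooth2_tauv.
  - by move=> p [].
have sv : @smooth2 R n true admissible (vspeed x phi c).
  by apply: (smooth2_subset sub); exact: smooth2_vspeed.
apply: (smooth2_eq (smooth2_mul sj sv)) => -[e s] [[Is _ _] _].
by rewrite /lagrangian (speed_vary I_open c x_smooth phi_smooth e Is).
Qed.

Lemma partial_e_lagrangian0 s : I s ->
  partial_e lagrangian (0, s) = first_variation L x phi c s.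
Proof.
move=> Is; have r0 := regular0 I_open c x_smooth phi_smooth x_arclength x_curved Is.
have dk m := smooth2_is_derive_e ro (smooth2_kappav n I_open c x_smooth phi_smooth false m) r0.
have dt m := smooth2_is_derive_e ro (smooth2_tauv n I_open c x_smooth phi_smooth false m) r0.
have Us : U (\row_(m < n.+1) kappav x phi c m (0, s), \row_(m < n.+1) tauv x phi c m (0, s)).
  by have [] := admissible0 Is.
have dL := smooth_on_differentiable L_smooth Us.
have dj := jet_chain_rule (f := fun m e => kappav x phi c m (e, s))
  (g := fun m e => tauv x phi c m (e, s)) dL (fun m => dk m) (fun m => dt m).
have dv := is_derive_vspeed I_open c x_smooth phi_smooth x_arclength Is.
rewrite (partial_e_eq (f := fun p => L (vjet p) * vspeed x phi c p) I_open x_smooth phi_smooth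
  r0 _ (is_derive_mul dj dv)); last first.
  move=> [e t] [It _ _].
  by rewrite /lagrangian (speed_vary I_open c x_smooth phi_smooth e It).
rewrite (vspeed0 I_open c x_smooth phi_smooth x_arclength Is) mul1r.
have -> : (\row_(m < n.+1) kappav x phi c m (0, s), \row_(m < n.+1) tauv x phi c m (0, s))
    = jet n x s.
  by rewrite -[LHS]/(vjet (0, s)) /vjet vary0.
by rewrite addrC.
Qed.

(** Differentiation under the integral sign with a constant as dominating function. Compactness of
    [a, b] makes admissibility and the bound on the [e]-derivative hold for all |e| < d with one
    [d]. *)
Lemma is_derive_action a b : a <= b -> (forall s, a <= s <= b -> I s) ->
  is_derive (0 : R) (1 : R) (fun e => action L a b (fun s => vary x phi c (e, s)))
    (\int[mu]_(s in `[a, b]) first_variation L x phi c s).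
Proof.
move=> ab abI; have ao := open_admissible.
have sl := smooth2_lagrangian; have sd := smooth2_partial_e ao sl.
(* The added 1 makes the bound strict at e = 0, so that it survives for nearby [e]. *)
have [M Mub] : exists M : R, forall s, a <= s <= b -> `|partial_e lagrangian (0, s)| + 1 <= M.
  have cN : {within `[a, b], continuous (fun s => `|partial_e lagrangian (0, s)|)}.
    apply: continuous_in_within => s /=; rewrite in_itv /= => sab.
    apply: continuous_comp; last exact: norm_continuous.
    have s1 := smooth2_slice ao (e0 := 0) I_open sd (fun t It => admissible0 It).
    exact: smooth1_continuous s1 (abI s sab).
  have [t _ Ht] := EVT_max ab cN.
  exists (`|partial_e lagrangian (0, t)| + 1) => s sab.
  by rewrite lerD2r; apply: Ht; rewrite in_itv.
have near0 : \forall e \near (0 : R), `[a, b]%classic `<=`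
    (fun s => admissible (e, s) /\ `|partial_e lagrangian (e, s)| <= M).
  (* The tube lemma: it suffices to control a neighbourhood of each point (0, s). *)
  have cov := (compact_near_coveringP _).1 (@segment_compact R a b).
  apply: (cov R (nbhs (0 : R)) (fun e s =>
    admissible (e, s) /\ `|partial_e lagrangian (e, s)| <= M)) => s /=.
  rewrite in_itv /= => sab.
  have a0 := admissible0 (abI s sab).
  have cd := smooth2_continuous ao sd a0.
  have nb : \forall q \near (0 : R, s), `|partial_e lagrangian q| <= M.
    have cn : (fun q => `|partial_e lagrangian q|) @ (0 : R, s) --> `|partial_e lagrangian (0, s)|.
      exact: (cvg_norm cd).
    apply: (cvgr_le _ cn); apply: lt_le_trans (Mub s sab).
    by rewrite ltrDl.
  have na : \forall q \near (0 : R, s), admissible q by apply: open_nbhs_nbhs; split.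
  have H : \forall q \near (0 : R, s), admissible q /\ `|partial_e lagrangian q| <= M.
    exact: (filterI na nb).
  have sw : (fun q : R * R => (q.2, q.1)) @ (s, 0 : R) --> (0 : R, s).
    have c1 : (fun q : R * R => q.1) @ (s, 0 : R) --> s by exact: cvg_fst.
    have c2 : (fun q : R * R => q.2) @ (s, 0 : R) --> (0 : R) by exact: cvg_snd.
    exact: (cvg_pair c2 c1).
  exact: (sw _ H).
have [d /= d0 dP] := near0.
have adm e s : `|e| < d -> a <= s <= b -> admissible (e, s) /\ `|partial_e lagrangian (e, s)| <= M.
  move=> ed sab; apply: (dP e); last by rewrite /= in_itv.
  by rewrite /= sub0r normrN.
have oo e : `](- d), d[%classic e -> `|e| < d by rewrite /= in_itv /= ltr_norml.
have I0 : `](- d), d[%classic (0 : R) by rewrite /= in_itv /= oppr_lt0 d0.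
have mI : @measurable _ (measurableTypeR R) `[a, b]%classic by exact: measurable_itv.
have M0 : 0 <= M by apply: le_trans (Mub a _); rewrite ?lexx // addr_ge0.
have intf e : `](- d), d[%classic e ->
    mu.-integrable `[a, b] (EFin \o (fun s => lagrangian (e, s))).
  move=> /oo ed; apply: continuous_integrable_itv => s sab.
  have [aes _] := adm e s ed sab.
  have := smooth2_is_derive_s ao sl aes => dl.
  by apply: differentiable_continuous; apply/derivable1_diffP; exact: dl.(ex_derive).
have derf e s : `](- d), d[%classic e -> `[a, b]%classic s ->
    derivable ((fun e s => lagrangian (e, s))^~ s) e 1.
  move=> /oo ed; rewrite /= in_itv /= => sab.
  have [aes _] := adm e s ed sab.
  exact: (smooth2_is_derive_e ao sl aes).(ex_derive).
have intG : mu.-integrable `[a, b] (EFin \o (cst M : R -> R)).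
  by apply: continuous_integrable_itv => s _; exact: cvg_cst.
have Gub e s : `](- d), d[%classic e -> `[a, b]%classic s ->
    `|partial1of2 (fun e s => lagrangian (e, s)) e s| <= M.
  by move=> /oo ed; rewrite /= in_itv /= => sab; have [] := adm e s ed sab.
have D1 := derivable_under_integral mI I0 intf derf (fun=> M0) intG Gub.
have D2 := differentiation_under_integral mI I0 intf derf (fun=> M0) intG Gub.
apply: DeriveDef; first exact: D1.
rewrite -derive1E; apply: (etrans D2).
apply: eq_Rintegral => s; rewrite inE /= in_itv /= => sab.
exact: partial_e_lagrangian0 (abI s sab).
Qed.

End ActionDerivative.

(** * Conservation of force and torque *)

Lemma dot3_scale (R : realType) (a b : 'I_3 -> R) (r : R) :
  dot3 a (fun i => r * b i) = dot3 a b * r.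
Proof. by rewrite /dot3; ring. Qed.

Lemma dot3_oppmx (R : realType) (a : 'I_3 -> R) (c : 'cV[R]_3) :
  dot3 a (fun i => (- c) i 0) = - dot3 a (fun i => c i 0).
Proof. by rewrite /dot3 !mxE; ring. Qed.

Lemma dot3_delta_mx (R : realType) (a : 'I_3 -> R) i :
  dot3 a (fun j => (delta_mx i 0 : 'cV[R]_3) j 0) = a i.
Proof. by rewrite /dot3 !mxE; elim/ord3P: i; rewrite /= !(mulr0, mulr1, addr0, add0r). Qed.

Lemma nested_itv (R : realType) (s r : R) : 0 < r ->
  [/\ s - r - r < s - r, s - r < s + r & s + r < s + r + r].
Proof. by move=> r0; split; lra. Qed.

Lemma nested_itv_ball (R : realType) (s t r : R) : 0 < r ->
  s - r - r <= t -> t <= s + r + r ->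
  - (r + r + r + r) < s - t < r + r + r + r.
Proof. by move=> r0 h1 h2; apply/andP; split; lra. Qed.

Section ForceConstant.
Variables (R : realType) (n : nat) (U : set (jets R n)) (L : jets R n -> R).
Variables (I : set R) (x : R -> 'cV[R]_3).
Hypothesis U_open : open U.
Hypothesis L_smooth : smooth_on U L.
Hypothesis I_open : open I.
Hypothesis x_smooth : smooth_on I x.
Hypothesis x_arclength : forall s, I s -> enorm (derive1 x s) = 1.
Hypothesis x_curved : forall s, I s -> curvature x s != 0.
Hypothesis x_jets : forall s, I s -> U (jet n x s).

Local Notation mu := (@lebesgue_measure R).

Lemma smooth1_subset (J J' : set R) (u : R -> R) : J' `<=` J -> smooth1 J u -> smooth1 J' u.
Proof. by move=> JJ' [su]; split=> k s /JJ'; exact: su. Qed.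

(** On an open set where [phi] vanishes so do its derivatives, hence [eta] and [stretch]; [dkappa]
    and [dtau] follow by induction on their order through the commutator recursion. *)
Lemma noether_flux_off (phi : R -> R) (c : 'cV[R]_3) (O : set R) s :
  smooth1 I phi -> open O -> O `<=` I -> (forall t, O t -> phi t = 0) -> O s ->
  noether_flux L x phi c s = 0.
Proof.
move=> sphi Oo OI phi0 Os.
have eta0 k i t : O t -> eta phi c k i t = 0.
  move=> Ot; rewrite /eta (derive1n_eq_on Oo (v := fun=> 0) k phi0 Ot).
  suff -> : derive1n k (fun _ : R => 0 : R) t = 0 by rewrite mul0r.
  elim: k t {Ot} => [//|k IHk] t; rewrite derive1nS.
  have -> : derive1n k (fun _ : R => 0 : R) = cst 0 by apply/funext.
  exact: derive1_cst.
have dot0 (w : 'I_3 -> R) k t : O t -> dot3 w (fun i => eta phi c k i t) = 0.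
  by move=> Ot; rewrite /dot3 !eta0 // !mulr0 !addr0.
have eps0 t : O t -> stretch x phi c t = 0 by exact: dot0.
have dk0 m t : O t -> dkappa x phi c m t = 0.
  elim: m t => [|m IHm] t Ot.
    rewrite (dkappa0E c I_open x_smooth x_arclength x_curved sphi (OI _ Ot)).
    by rewrite dot0 // eps0 // mul0r mulr0 subr0.
  have D := is_derive_dkappa n c I_open x_smooth x_arclength x_curved sphi m (OI _ Ot).
  have := is_derive1E D; rewrite eps0 // mul0r addr0 => <-.
  by rewrite (derive1_eq_on Oo (v := cst 0) IHm Ot) derive1_cst.
have dt0 m t : O t -> dtau x phi c m t = 0.
  elim: m t => [|m IHm] t Ot.
    have dtau_zero (k k1 u e p1 p2 p3 q : R) : p3 = 0 -> p2 = 0 -> p1 = 0 -> q = 0 -> e = 0 ->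
        p3 / k ^+ 2 - k1 / k ^+ 3 * p2 + p1 - u / k ^+ 2 * q - u * e = 0.
      by move=> -> -> -> -> ->; rewrite !mulr0 mul0r !subr0 addr0.
    apply: (etrans (dtau0E c I_open x_smooth x_arclength x_curved sphi (OI _ Ot))).
    exact: dtau_zero (dot0 _ 3%N t Ot) (dot0 _ 2%N t Ot) (dot0 _ 1%N t Ot)
      (dot0 _ 2%N t Ot) (eps0 t Ot).
  have D := is_derive_dtau n c I_open x_smooth x_arclength x_curved sphi m (OI _ Ot).
  have := is_derive1E D; rewrite eps0 // mul0r addr0 => <-.
  by rewrite (derive1_eq_on Oo (v := cst 0) IHm Ot) derive1_cst.
rewrite /noether_flux !dot0 // !mulr0 subr0 !addr0.
rewrite !big1 ?addr0 // => m _; apply: big1 => i _; first by rewrite dt0 // mulr0.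
by rewrite dk0 // mulr0.
Qed.

Hypothesis x_extremal : extremal L I x.

Definition force_along (c : 'cV[R]_3) s := dot3 (fun i => force L x i s) (fun i => c i 0).

Lemma smooth1_force_along c : smooth1 I (force_along c).
Proof.
have sF i := smooth1_force L_smooth I_open x_smooth x_arclength x_curved x_jets i.
have M i : smooth1 I (fun s => force L x i s * c i 0).
  by apply: (smooth1_mul I_open (sF i)); exact: smooth1_cst.
by apply: (smooth1_add I_open) => //; apply: (smooth1_add I_open).
Qed.

(** Adding phi (F . c) to the flux trades the term - phi' (F . c) in its derivative for phi (F .
    c)'. The sum vanishes at a' and b', which the strict inequalities place in the open set [I]
    minus [a, b], and the first variation integrates to zero on an extremal. *)
Lemma weak_force_equation (c : 'cV[R]_3) (a' a b b' : R) :
  a' < a -> a < b -> b < b' -> (forall s, a' <= s <= b' -> I s) ->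
  \int[mu]_(s in `[a', b']) (bump a b s * derive1 (force_along c) s) = 0.
Proof.
move=> a'a ab bb' abI; have a'b' : a' < b' by rewrite (lt_trans a'a) // (lt_trans ab).
have sphi : smooth1 I (bump a b) := smooth1_subset (@subsetT _ I) (smooth1_bump a b).
set phi := bump a b.
have var d : curve_variation I x d a' b' (vary x phi c).
  split.
  - by move=> s /=; rewrite in_itv /=; exact: abI.
  - exact: smooth_on_vary.
  - by move=> s _; rewrite -{2}(vary0 x phi c).
  - move=> e s _ _ ns; rewrite /vary /= [phi s]bump_eq0 ?mulr0 ?scale0r ?addr0 //.
    by move=> /andP[sa sb]; apply: ns; rewrite (le_trans (ltW a'a) sa) (le_trans sb (ltW bb')).
have D0 := x_extremal ltr01 (ltW a'b') (var 1).
have D1 := is_derive_action c U_open L_smooth I_open x_smooth x_arclength x_curved x_jets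
  sphi (ltW a'b') abI.
have fv0 : \int[mu]_(s in `[a', b']) first_variation L x phi c s = 0.
  exact: is_derive_unique D1 D0.
have sg' := smooth1_derive (smooth1_force_along c).
have cg s : a' <= s <= b' -> {for s, continuous (fun s => phi s * derive1 (force_along c) s)}.
  by move=> /abI Is; exact: (smooth1_continuous (smooth1_mul I_open sphi sg') Is).
have cfv s : a' <= s <= b' -> {for s, continuous (first_variation L x phi c)}.
  move=> /abI Is.
  have sK (m : 'I_n.+1) : smooth1 I (fun s => dkappa x phi c m s * dL_kappa L m (jet n x s)).
    apply: (smooth1_mul I_open); last exact: smooth1_Lk.
    exact: smooth1_dkappa.
  have sT (m : 'I_n.+1) : smooth1 I (fun s => dtau x phi c m s * dL_tau L m (jet n x s)).
    apply: (smooth1_mul I_open); last exact: smooth1_Lt.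
    exact: smooth1_dtau.
  have sx k i := smooth1_xD I_open x_smooth k i.
  have se k i : smooth1 I (eta phi c k i).
    by apply: (smooth1_mul I_open); [exact: smooth1_derive1n|exact: smooth1_cst].
  have sxe i : smooth1 I (fun s => xD x 1 i s * eta phi c 1 i s) by exact: smooth1_mul.
  have sL := smooth1_jet I_open x_smooth x_arclength x_curved x_jets L_smooth.
  have sfv : smooth1 I (first_variation L x phi c).
    apply: (smooth1_add I_open).
      apply: (smooth1_add I_open).
        exact: (smooth1_sum I_open _ _ sK).
      exact: (smooth1_sum I_open _ _ sT).
    apply: (smooth1_mul I_open sL).
    by apply: (smooth1_add I_open) => //; apply: (smooth1_add I_open).
  exact: smooth1_continuous sfv Is.
pose P s := noether_flux L x phi c s + phi s * force_along c s.
have dP s : a' <= s <= b' -> is_derive s (1 : R) P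
    (first_variation L x phi c s + phi s * derive1 (force_along c) s).
  move=> /abI Is.
  have df := is_derive_noether_flux c L_smooth I_open x_smooth x_arclength x_curved x_jets sphi Is.
  have dg := is_derive_mul (smooth1_is_derive sphi Is)
     (smooth1_is_derive (smooth1_force_along c) Is).
  have E : dot3 (fun i => force L x i s) (fun i => eta phi c 1 i s) =
      force_along c s * derive1 phi s.
    exact: dot3_scale.
  have cancel (u v v' w : R) : v = v' -> u - v + (w + v') = u + w by move=> ->; ring.
  exact: (is_derive_eq (is_derive_add df dg) (cancel _ _ _ _ E)).
have P0 s : I s -> ~ (a <= s <= b) -> P s = 0.
  move=> Is ns; rewrite /P [phi s]bump_eq0 // mul0r addr0.
  have Oo : open (I `&` ~` `[a, b]%classic).
    by apply: openI => //; apply: closed_openC; exact: interval_closed.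
  have phi0 t : (I `&` ~` `[a, b]%classic) t -> phi t = 0.
    by move=> [_ nt]; apply: bump_eq0 => tab; apply: nt; rewrite /= in_itv.
  apply: (noether_flux_off c sphi Oo (@subIsetl _ _ _) phi0).
  by split => // tab; apply: ns; move: tab; rewrite /= in_itv.
have Pa : P a' = 0.
  apply: P0; first by apply: abI; rewrite lexx ltW.
  by move=> /andP[+ _]; rewrite leNgt a'a.
have Pb : P b' = 0.
  apply: P0; first by apply: abI; rewrite lexx ltW.
  by move=> /andP[_]; rewrite leNgt bb'.
have cP s : a' <= s <= b' ->
    {for s, continuous (fun s => first_variation L x phi c s + phi s * derive1 (force_along c) s)}.
  by move=> sab; apply: cvgD; [exact: cfv|exact: cg].
have := Rintegral_is_derive a'b' cP dP.
rewrite Pa Pb subrr RintegralD; last exact: continuous_integrable_itv.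
- by rewrite fv0 add0r.
- exact: measurable_itv.
- exact: continuous_integrable_itv.
Qed.

(** One half of the fundamental lemma of the calculus of variations: against a bump where the
    derivative is positive, the integral could not vanish. The other half is the case - c. *)
Lemma force_along_derive_le0 c s0 : I s0 -> derive1 (force_along c) s0 <= 0.
Proof.
move=> Is0; rewrite leNgt; apply/negP => g0.
have sg' := smooth1_derive (smooth1_force_along c).
have ng : \forall s \near s0, 0 < derive1 (force_along c) s.
  by apply: (cvgr_gt _ (smooth1_continuous sg' Is0)).
have nI : \forall s \near s0, I s by apply: open_nbhs_nbhs; split.
have H : \forall s \near s0, I s /\ 0 < derive1 (force_along c) s.
  exact: (filterI nI ng).
have [d /= d0 dP] := H.
(* The bump lives within r of s0 and the variation within 2r, well inside the ball of radius d =
   4r. *)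
pose r := d / 4; have r0 : 0 < r by rewrite divr_gt0.
have Hs s : s0 - r - r <= s <= s0 + r + r -> I s /\ 0 < derive1 (force_along c) s.
  move=> /andP[s1 s2]; apply: dP; rewrite /= ltr_norml.
  have dE : d = r + r + r + r by rewrite /r; field.
  by rewrite dE; exact: nested_itv_ball.
have [la ab lb] := nested_itv s0 r0.
have w0 := @weak_force_equation c (s0 - r - r) (s0 - r) (s0 + r) (s0 + r + r)
  la ab lb (fun s sab => (Hs s sab).1).
have sphi : smooth1 I (bump (s0 - r) (s0 + r)) :=
  smooth1_subset (@subsetT _ I) (smooth1_bump _ _).
have cf s : s0 - r - r <= s <= s0 + r + r ->
    {for s, continuous (fun s => bump (s0 - r) (s0 + r) s * derive1 (force_along c) s)}.
  by move=> sab; exact: (smooth1_continuous (smooth1_mul I_open sphi sg') (Hs s sab).1).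
have f0 s : s0 - r - r <= s <= s0 + r + r ->
    0 <= bump (s0 - r) (s0 + r) s * derive1 (force_along c) s.
  by move=> sab; exact: mulr_ge0 (bump_ge0 _ _ _) (ltW (Hs s sab).2).
have [s /andP[s1 s2] e0] := Rintegral_ge0_eq0 (c := s0 - r) (d := s0 + r)
  (ltW la) ab (ltW lb) cf f0 w0.
have sab : s0 - r - r <= s <= s0 + r + r by rewrite (ltW (lt_trans la s1)) (ltW (lt_trans s2 lb)).
by have := mulr_gt0 (bump_gt0 s1 s2) (Hs s sab).2; rewrite e0 ltxx.
Qed.

Lemma force_along_derive_eq0 c s : I s -> derive1 (force_along c) s = 0.
Proof.
move=> Is; apply/eqP; rewrite eq_le force_along_derive_le0 //=.
have dg := smooth1_is_derive (smooth1_force_along c) Is.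
have := force_along_derive_le0 (- c) Is.
have -> : force_along (- c) = (fun s => - force_along c s).
  by apply/funext => t; exact: dot3_oppmx.
by rewrite (is_derive1E (is_deriveN dg)) oppr_le0.
Qed.

Lemma is_derive_force i s : I s -> is_derive s (1 : R) (force L x i) 0.
Proof.
move=> Is; have -> : force L x i = force_along (delta_mx i 0).
  by apply/funext => t; rewrite -[RHS]/(dot3 _ _) dot3_delta_mx.
rewrite -(force_along_derive_eq0 (delta_mx i 0) Is).
exact: smooth1_is_derive (smooth1_force_along _) Is.
Qed.

End ForceConstant.

Lemma is_derive0_cst_itv (R : realType) (I : set R) (f : R -> R) : is_interval I ->
  (forall s, I s -> is_derive s (1 : R) f 0) -> forall s t, I s -> I t -> f s = f t.
Proof.
move=> Ii df.
suff H s t : s <= t -> I s -> I t -> f s = f t.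
  by move=> s t Is It; have [st|/ltW ts] := leP s t; [exact: H|apply/esym; exact: H].
move=> st Is It.
have sI u : s <= u <= t -> I u by exact: Ii.
have cf : {within `[s, t], continuous f}.
  apply: continuous_in_within => u /=; rewrite in_itv /= => /sI Iu.
  by apply: differentiable_continuous; apply/derivable1_diffP; exact: (df u Iu).(ex_derive).
have dfo u : u \in `]s, t[%R -> is_derive u (1 : R) f ((fun=> 0) u).
  by rewrite in_itv /= => /andP[su ut]; apply: df; apply: sI; rewrite !ltW.
have [w _] := MVT_segment st dfo cf.
by rewrite mul0r => /eqP; rewrite subr_eq0 => /eqP.
Qed.

(** * Algebra of the Frenet frame and of the matrix in the conservation laws *)

Section FrameAlgebra.
Variable R : realType.
Implicit Types a b : 'I_3 -> R.

(** The vector with coordinates p1, p2, p3 in the frame a, b / k, (a x b) / k, orthonormal when a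
    and b are x_s and x_ss. *)
Definition comb3 a b (k p1 p2 p3 : R) (i : 'I_3) : R :=
  p1 * a i + p2 / k * b i + p3 / k * cross3 a b i.

Lemma dot3_comb3 a b (k p1 p2 p3 q1 q2 q3 : R) : k != 0 ->
  dot3 a a = 1 -> dot3 a b = 0 -> dot3 b b = k ^+ 2 ->
  dot3 (comb3 a b k p1 p2 p3) (comb3 a b k q1 q2 q3) = p1 * q1 + p2 * q2 + p3 * q3.
Proof.
move=> k0 eaa eab ebb.
transitivity (p1 * q1 * dot3 a a + p2 / k * (q2 / k) * dot3 b b
  + p3 / k * (q3 / k) * (dot3 a a * dot3 b b - dot3 a b ^+ 2)
  + (p1 * (q2 / k) + p2 / k * q1) * dot3 a b).
  by rewrite /comb3 /dot3 !cross3E; ring.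
by rewrite eaa eab ebb; field.
Qed.

Lemma dot3_cross_self a b : dot3 b (cross3 a b) = 0.
Proof. by rewrite /dot3 !cross3E; ring. Qed.

Lemma dot3D a b b' : dot3 a (fun i => b i + b' i) = dot3 a b + dot3 a b'.
Proof. by rewrite /dot3; ring. Qed.

(** T x F = F2 B - F3 N, and the definitions of F2 and F3 are exactly what makes the derivative of
    the couple its negative; d and da stand for the derivatives of x_ss and x_s x x_ss. *)
Lemma torque_algebra a b (f d da : 'I_3 -> R) (k k1 t E E1 E2 G G1 f1 f2 f3 : R) (i : 'I_3) :
  k != 0 -> dot3 a a = 1 -> dot3 a b = 0 ->
  (forall i, f i = comb3 a b k f1 f2 f3 i) ->
  d i = - k ^+ 2 * a i + k1 / k * b i + t * cross3 a b i ->
  da i = k1 / k * cross3 a b i - t * b i ->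
  f2 = - G1 - t / k * E1 ->
  f3 = k^-1 * E2 - k1 / k ^+ 2 * E1 + k * E - t * G ->
  let vd := - k1 * k^-1 * k^-1 in
  cross3 a f i
  + ((E * b i + a i * E1)
     + (E1 * (k^-1 * k^-1) * d i + b i * (E1 * (k^-1 * vd + k^-1 * vd) + k^-1 * k^-1 * E2))
     + (G * k^-1 * da i + cross3 a b i * (G * vd + k^-1 * G1))) = 0.
Proof.
move=> k0 eaa eab ef ed eda e2 e3 /=.
have -> : cross3 a f i = f2 / k * cross3 a b i
    + f3 / k * (dot3 a b * a i - dot3 a a * b i).
  by elim/ord3P: i {ed eda}; rewrite /dot3 !cross3E !ef /comb3 !cross3E; ring.
by rewrite eaa eab ed eda e2 e3; field.
Qed.

Lemma rhoFS_mul (x : R -> 'cV[R]_3) s (u : 'cV[R]_3) i :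
  (rhoFS x s *m u) i 0 = derive1 x s i 0 * u 0 0
    + (curvature x s)^-1 * derive1n 2 x s i 0 * u 1 0
    + (curvature x s)^-1 * crossp (derive1 x s) (derive1n 2 x s) i 0 * u 2 0.
Proof.
have key (A : 'M[R]_3) (v : 'cV[R]_3) j :
    (A *m v) j 0 = A j 0 * v 0 0 + A j 1 * v 1 0 + A j 2 * v 2 0.
  by rewrite mxE sum_ord3.
rewrite key; congr (_ * _ + _ * _ + _ * _); rewrite [LHS]mxE /=.
- by [].
- by rewrite [LHS]mxE.
- by rewrite [LHS]mxE.
Qed.

Lemma Xmx_mul (u v : 'cV[R]_3) i :
  (Xmx u *m v) i 0 = cross3 (fun i => u i 0) (fun i => v i 0) i.
Proof.
by rewrite mxE sum_ord3 !mxE; elim/ord3P: i; rewrite !cross3E /=; ring.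
Qed.

Definition Dsign (i : 'I_3) : R := [:: 1; -1; 1]`_i.

Lemma Dmx_mul (v : 'cV[R]_3) i : (Dmx R *m v) i 0 = Dsign i * v i 0.
Proof. by rewrite mul_diag_mx !mxE. Qed.

End FrameAlgebra.

(** * The torque, the conservation laws and their invariants *)

Section Torque.
Variables (R : realType) (n : nat) (U : set (jets R n)) (L : jets R n -> R).
Variables (I : set R) (x : R -> 'cV[R]_3).
Hypothesis U_open : open U.
Hypothesis L_smooth : smooth_on U L.
Hypothesis I_open : open I.
Hypothesis x_smooth : smooth_on I x.
Hypothesis x_arclength : forall s, I s -> enorm (derive1 x s) = 1.
Hypothesis x_curved : forall s, I s -> curvature x s != 0.
Hypothesis x_jets : forall s, I s -> U (jet n x s).
Hypothesis x_extremal : extremal L I x.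

Local Notation K := (curvature x).
Local Notation T := (torsion x).
Local Notation Ds := (arcD x).
Local Notation Ek := (Euler_kappa L x).
Local Notation Et := (Euler_tau L x).
Local Notation A := (xcross x).
Local Notation xv k s := (fun i => xD x k i s).
Local Notation F s := (fun i => force L x i s).

(** In the middle term one inverse of [K s] belongs to the coefficient and the other normalizes
    x_ss. Its sign is opposite to that in [upsilon], because the inner D intervenes. *)
Definition couple i s :=
  Et s * xD x 1 i s + Ds Et s * ((K s)^-1 * (K s)^-1) * xD x 2 i s + Ek s * (K s)^-1 * A s i.

Definition torque i s := cross3 (xv 0 s) (F s) i + couple i s.

Lemma force_comb3 s i :
  force L x i s = comb3 (xv 1 s) (xv 2 s) (K s) (force1 L x s) (force2 L x s) (force3 L x s) i.
Proof. by []. Qed.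

Lemma couple_comb3 s i :
  couple i s = comb3 (xv 1 s) (xv 2 s) (K s) (Et s) ((K s)^-1 * Ds Et s) (Ek s) i.
Proof.
rewrite /couple /comb3; congr (_ + _ * _ + _).
by rewrite mulrC mulrAC.
Qed.

Lemma is_derive_torque i s : I s -> is_derive s (1 : R) (torque i) 0.
Proof.
move=> Is; have k0 := x_curved Is.
have sEk := smooth1_Euler_kappa L_smooth I_open x_smooth x_arclength x_curved x_jets.
have sEt := smooth1_Euler_tau L_smooth I_open x_smooth x_arclength x_curved x_jets.
have dEt := is_derive_arcD x_arclength sEt Is.
have dEt1 := is_derive_arcD x_arclength (smooth1_arcD I_open x_arclength sEt) Is.
have dEk := is_derive_arcD x_arclength sEk Is.
have dV := is_derive_inv k0 (is_derive_curvature I_open x_smooth x_arclength x_curved Is).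
have dF j := is_derive_force U_open L_smooth I_open x_smooth x_arclength x_curved x_jets
  x_extremal j Is.
have dx k j := is_derive_xD I_open x_smooth k j Is.
have dA := is_derive_xcross I_open x_smooth i Is.
have D0 := is_derive_cross3 i (dx 0%N) dF.
have D1 := is_derive_mul dEt (dx 1%N i).
have D2 := is_derive_mul (is_derive_mul dEt1 (is_derive_mul dV dV)) (dx 2%N i).
have D3 := is_derive_mul (is_derive_mul dEk dV) dA.
have D := is_derive_add D0 (is_derive_add (is_derive_add D1 D2) D3).
have c0 (a : 'I_3 -> R) : cross3 a (fun=> 0) i = 0.
  by elim/ord3P: (i); rewrite !cross3E; ring.
have alg := torque_algebra (d := xv 3 s) k0 (sq_tangent I_open x_smooth x_arclength Is)
  (tangent_accel I_open x_smooth x_arclength Is) (force_comb3 s)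
  (jerkE I_open x_smooth x_arclength x_curved i Is)
  (dxcrossE I_open x_smooth x_arclength x_curved i Is) erefl erefl.
have add_zero (u v w : R) : v = 0 -> u + w = 0 -> u + v + w = 0 by move=> ->; rewrite addr0.
exact: (is_derive_eq D (add_zero _ _ _ (c0 _) alg)).
Qed.

(** The upper block row gives rho v1 = F. The lower one factors as D (X rho v1 + rho D v2), where X
    acts as the cross product with x and D v2 holds the frame coordinates of the couple: it equals D
    applied to the torque. *)
Lemma noether_laws_force_torque (c1 c2 : 'cV[R]_3) :
  (forall s i, I s -> force L x i s = c1 i 0) ->
  (forall s i, I s -> Dsign R i * torque i s = c2 i 0) ->
  noether_laws L I x c1 c2.
Proof.
move=> F1 T2 s Is.
have x1 i : derive1 x s i 0 = xD x 1 i s by exact: (derive1n_coord 1 i I_open x_smooth Is).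
have x2 i : derive1n 2 x s i 0 = xD x 2 i s by exact: (derive1n_coord 2 i I_open x_smooth Is).
have xA i : crossp (derive1 x s) (derive1n 2 x s) i 0 = A s i.
  by rewrite crosspE; apply: eq_cross3 => j; [exact: x1|exact: x2].
have rho (u : 'cV[R]_3) i : (rhoFS x s *m u) i 0 =
    comb3 (xv 1 s) (xv 2 s) (K s) (u 0 0) (u 1 0) (u 2 0) i.
  have alg (p q r k y z w : R) : p * y + k * q * z + k * r * w = y * p + z * k * q + w * k * r.
    by ring.
  by rewrite rhoFS_mul (x1 i) (x2 i) (xA i); exact: alg.
rewrite /upsilon mul_block_col mul0mx addr0; congr col_mx.
  apply/matrixP => i j; rewrite ord1 rho -(F1 s i Is).
  by rewrite [in LHS]/comb3 !mxE.
apply/matrixP => i j; rewrite ord1 -(T2 s i Is) [LHS]mxE.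
rewrite -!mulmxA !Dmx_mul -mulrDr; congr (_ * _).
rewrite Xmx_mul rho /torque; congr (_ + _).
  apply: eq_cross3 => k //; rewrite rho.
  by rewrite [in LHS]/comb3 !mxE.
rewrite couple_comb3; congr (comb3 _ _ _ _ _ _ _);
  apply: (etrans (Dmx_mul _ _)); rewrite [in LHS]mxE /Dsign /=.
- by rewrite mul1r.
- by rewrite mulN1r mulNr opprK.
- by rewrite mul1r.
Qed.

(** The frame is orthonormal, and x x F is orthogonal to F, so only the couple contributes to the
    second product. *)
Lemma first_integrals s : I s ->
  dot3 (F s) (F s) = force1 L x s ^+ 2 + force2 L x s ^+ 2 + force3 L x s ^+ 2 /\
  dot3 (F s) (fun i => torque i s) = force1 L x s * Et s
    + force2 L x s * ((K s)^-1 * Ds Et s) + force3 L x s * Ek s.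
Proof.
move=> Is; have k0 := x_curved Is.
have e1 := sq_tangent I_open x_smooth x_arclength Is.
have e2 := tangent_accel I_open x_smooth x_arclength Is.
have e3 := sq_accel I_open x_smooth x_arclength Is.
have d p1 p2 p3 q1 q2 q3 := dot3_comb3 p1 p2 p3 q1 q2 q3 k0 e1 e2 e3.
split; first exact: d.
apply: (etrans (dot3D _ _ _)); rewrite dot3_cross_self add0r.
apply: (etrans (eq_dot3 (force_comb3 s) (couple_comb3 s))).
exact: d.
Qed.

End Torque.

Theorem mainTheorem4 (R : realType) (n : nat)
    (U : set (jets R n)) (L : jets R n -> R)
    (I : set R) (x : R -> 'cV[R]_3)
    (U_open : open U) (L_smooth : smooth_on U L)
    (I_open : open I) (I_interval : is_interval I)
    (x_smooth : smooth_on I x)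
    (x_arclength : forall s, I s -> enorm (derive1 x s) = 1)
    (x_curved : forall s, I s -> curvature x s != 0)
    (x_jets : forall s, I s -> U (jet n x s))
    (x_extremal : extremal L I x) :
  let kappa := curvature x in
  let tau := torsion x in
  let Ds := arcD x in
  let Ek := Euler_kappa L x in
  let Et := Euler_tau L x in
  exists c1 c2 : 'cV[R]_3,
    noether_laws L I x c1 c2 /\
    forall s, I s ->
      (tau s * Et s - kappa s * Ek s - lambda L x s) ^+ 2
      + (- Ds Ek s - tau s / kappa s * Ds Et s) ^+ 2
      + ((kappa s)^-1 * Ds (Ds Et) s - Ds kappa s / kappa s ^+ 2 * Ds Et s
         + kappa s * Et s - tau s * Ek s) ^+ 2
      = c1 0 0 ^+ 2 + c1 1 0 ^+ 2 + c1 2 0 ^+ 2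
      /\
      (tau s * Et s - kappa s * Ek s - lambda L x s) * Et s
      + (- Ds Ek s - tau s / kappa s * Ds Et s) * ((kappa s)^-1 * Ds Et s)
      + ((kappa s)^-1 * Ds (Ds Et) s - Ds kappa s / kappa s ^+ 2 * Ds Et s
         + kappa s * Et s - tau s * Ek s) * Ek s
      = c1 0 0 * c2 0 0 - c1 1 0 * c2 1 0 + c1 2 0 * c2 2 0.
Proof.
move=> kappa tau Ds Ek Et.
have [[s0 Is0]|noI] := pselect (exists s, I s); last first.
  (* On an empty [I] any two constants satisfy the laws. *)
  by exists 0, 0; split => s Is; case: noI; exists s.
(* The constants are the values of F and of D torque at a base point; since D^2 = 1, the torque is
   recovered as D c2. *)
pose c1 : 'cV[R]_3 := \col_i force L x i s0.
pose c2 : 'cV[R]_3 := \col_i (Dsign R i * torque L x i s0).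
have F1 s i : I s -> force L x i s = c1 i 0.
  move=> Is; rewrite [RHS]mxE; apply: (is_derive0_cst_itv I_interval _ Is Is0) => t It.
  exact: (is_derive_force U_open L_smooth I_open x_smooth x_arclength x_curved x_jets
    x_extremal i It).
have T2 s i : I s -> torque L x i s = Dsign R i * c2 i 0.
  move=> Is; rewrite mxE mulrA.
  have -> : Dsign R i * Dsign R i = 1.
    by elim/ord3P: i; rewrite /Dsign /= ?mulr1 ?mulrNN ?mulr1.
  rewrite mul1r; apply: (is_derive0_cst_itv I_interval _ Is Is0) => t It.
  exact: (is_derive_torque U_open L_smooth I_open x_smooth x_arclength x_curved x_jets
    x_extremal i It).
exists c1, c2; split.
  apply: (noether_laws_force_torque I_open x_smooth F1) => s i Is.
  rewrite (T2 s i Is) mulrA (_ : Dsign R i * Dsign R i = 1) ?mul1r //.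
  by elim/ord3P: i; rewrite /Dsign /= ?mulr1 ?mulrNN ?mulr1.
move=> s Is.
have [e1 e2] := first_integrals L I_open x_smooth x_arclength x_curved Is.
have eF : dot3 (fun i => force L x i s) (fun i => force L x i s) =
    dot3 (fun i => c1 i 0) (fun i => c1 i 0) by apply: eq_dot3 => i; exact: F1.
(* F . torque = c1 . D c2: the middle entry of D is the source of the minus sign in the second
   integral. *)
have eT : dot3 (fun i => force L x i s) (fun i => torque L x i s) =
    dot3 (fun i => c1 i 0) (fun i => Dsign R i * c2 i 0).
  by apply: eq_dot3 => i; [exact: F1|exact: T2].
split; first by apply: (etrans (esym e1)); apply: (etrans eF); rewrite /dot3 !expr2.
apply: (etrans (esym e2)); apply: (etrans eT).
by rewrite /dot3 /Dsign /= !mul1r mulN1r mulrN.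
Qed.
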